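(* Let $R$ be a Noetherian commutative ring with non-zero identity and $I$ an ideal of $R$. Let $M$ be a finitely generated $R$-module, $N$ a weakly Laskerian $R$-module and $t$ a non-negative integer. If $R^iD_I(N)$ is weakly Laskerian for all $i<t$, then $\mathrm{Ass}(R^tD_I(M,N))$ is a finite set.
   Context: For $R$-modules $M,N$, the generalized ideal transform is $D_I(M,N)=\varinjlim_n \mathrm{Hom}_R(I^nM,N)$, the transition maps being restriction along $I^{j}M\subseteq I^{i}M$ for $i\le j$; $R^iD_I(M,-)$ denotes the $i$-th right derived functor of $D_I(M,-)$ (so $R^0D_I(M,-)=D_I(M,-)$), and it is isomorphic to $\varinjlim_n \mathrm{Ext}^i_R(I^nM,-)$. The ordinary ideal transform is $D_I(N)=\varinjlim_n\mathrm{Hom}_R(I^n,N)=D_I(R,N)$ and $R^iD_I(N)$ is the value at $N$ of its $i$-th right derived functor. An $R$-module is weakly Laskerian if every quotient module of it has only finitely many associated primes. *)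

(* Defs.v *)
From HB Require Import structures.
From mathcomp Require Import all_boot all_order all_algebra.
From mathcomp Require Import generic_quotient ring_quotient.
From mathcomp Require Import boolp classical_sets functions cardinality.

Set Implicit Arguments.
Unset Strict Implicit.
Unset Printing Implicit Defensive.

Import GRing.Theory.
Local Open Scope ring_scope.
Local Open Scope quotient_scope.

Section Submodule.
Variables (R : comNzRingType) (M : lmodType R).

(* Unlike [submodClosed], this bundle gives [submod_pred S] the [zmodClosed]
   structure required by [Quotient.quot]. *)
Record submodule := Submodule {
  submod_pred :> {pred M};
  submod_predP : submod_closed submod_pred }.

HB.instance Definition _ (S : submodule) :=
  GRing.isSubmodClosed.Build R M (submod_pred S)
    (GRing.submod_closed_semi (submod_predP S)).

Record submod_type (S : submodule) := SubmodElt {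
  submod_val : M;
  submod_valP : submod_val \in submod_pred S }.

HB.instance Definition _ (S : submodule) :=
  [isSub of submod_type S for @submod_val S].
HB.instance Definition _ (S : submodule) := [Choice of submod_type S by <:].
HB.instance Definition _ (S : submodule) :=
  [SubChoice_isSubZmodule of submod_type S by <:].
HB.instance Definition _ (S : submodule) :=
  [SubZmodule_isSubLmodule of submod_type S by <:].

Definition submod_full_pred : {pred M} := xpredT.
Lemma submod_full_closed : submod_closed submod_full_pred.
Proof. by split. Qed.
Definition submod_full := Submodule submod_full_closed.

End Submodule.

Section QuotientModule.
Variables (R : comNzRingType) (M : lmodType R) (S : submodule M).

Definition quotmod : Type := Quotient.quot (submod_pred S).
HB.instance Definition _ :=
  GRing.Zmodule.copy quotmod (Quotient.quot (submod_pred S)).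
HB.instance Definition _ :=
  EqQuotient.copy quotmod (Quotient.quot (submod_pred S)).

Lemma quotmod_eqP (x y : M) :
  (\pi_quotmod x = \pi_quotmod y) <-> (x - y \in submod_pred S).
Proof. by rewrite Quotient.idealrBE; split=> [e|/eqP //]; apply/eqP. Qed.

Lemma quotmod_piD (x y : M) :
  \pi_quotmod (x + y) = \pi_quotmod x + \pi_quotmod y.
Proof. exact: (Quotient.pi_add (submod_pred S)). Qed.

Definition quotmod_scale (a : R) (x : quotmod) : quotmod :=
  \pi_quotmod (a *: repr x).

Lemma quotmod_pi_scale a (x : M) :
  \pi_quotmod (a *: x) = quotmod_scale a (\pi_quotmod x).
Proof.
apply/quotmod_eqP; rewrite -scalerBr; apply: rpredZ.
by apply/quotmod_eqP; rewrite reprK.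
Qed.

Lemma quotmodP (x : quotmod) : exists y : M, x = \pi_quotmod y.
Proof. by exists (repr x); rewrite reprK. Qed.

Fact quotmod_scalerA a b x :
  quotmod_scale a (quotmod_scale b x) = quotmod_scale (a * b) x.
Proof.
by have [y ->] := quotmodP x; rewrite -!quotmod_pi_scale scalerA.
Qed.

Fact quotmod_scale1r : left_id 1 quotmod_scale.
Proof.
by move=> x; have [y ->] := quotmodP x; rewrite -quotmod_pi_scale scale1r.
Qed.

Fact quotmod_scalerDr : right_distributive quotmod_scale +%R.
Proof.
move=> a x y; have [u ->] := quotmodP x; have [v ->] := quotmodP y.
by rewrite -quotmod_piD -!quotmod_pi_scale scalerDr quotmod_piD.
Qed.

Fact quotmod_scalerDl x : {morph quotmod_scale^~ x : a b / a + b}.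
Proof.
move=> a b; have [y ->] := quotmodP x.
by rewrite -!quotmod_pi_scale scalerDl quotmod_piD.
Qed.

HB.instance Definition _ := GRing.Zmodule_isLmodule.Build R quotmod
  quotmod_scalerA quotmod_scale1r quotmod_scalerDr quotmod_scalerDl.

End QuotientModule.

Section HomModule.
Variables (R : comNzRingType) (U V : lmodType R).

Definition linear_pred : {pred U -> V} := fun f => `[< linear f >].

Lemma linear_pred_closed : submod_closed linear_pred.
Proof.
split=> [|a f g /asboolP fL /asboolP gL]; apply/asboolP=> b x y.
  by rewrite [LHS]/(0 : V) [X in _ = _ *: X + _]/(0 : V) scaler0 addr0.
rewrite -[LHS]/(a *: f (b *: x + y) + g (b *: x + y)).
rewrite -[RHS]/(b *: (a *: f x + g x) + (a *: f y + g y)) fL gL.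
by rewrite !scalerDr !scalerA mulrC addrACA.
Qed.

Definition linear_maps : submodule (U -> V) := Submodule linear_pred_closed.

Definition Hom : Type := submod_type linear_maps.
HB.instance Definition _ := GRing.Lmodule.on Hom.

Definition hom_fun (f : Hom) : U -> V := submod_val f.

Lemma hom_funP (f : Hom) : linear (hom_fun f).
Proof. exact/asboolP/(submod_valP f). Qed.

HB.instance Definition _ (f : Hom) :=
  GRing.isLinear.Build R U V *:%R (hom_fun f) (hom_funP f).

Definition hom_of (f : {linear U -> V}) : Hom :=
  @SubmodElt R (U -> V) linear_maps f (asboolT (@linearP _ _ _ _ f)).

Lemma hom_eqP (f g : Hom) : hom_fun f =1 hom_fun g -> f = g.
Proof. by move=> fg; apply: val_inj; apply/funext. Qed.

End HomModule.

Section DirectLimit.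
Variable R : comNzRingType.

Record dirsys := DirSys {
  ds_obj :> nat -> lmodType R;
  ds_map : forall i j, (i <= j)%N -> {linear ds_obj i -> ds_obj j};
  ds_map_id : forall i (h : (i <= i)%N) x, ds_map h x = x;
  ds_map_comp : forall i j k (hij : (i <= j)%N) (hjk : (j <= k)%N)
    (hik : (i <= k)%N) x, ds_map hjk (ds_map hij x) = ds_map hik x }.

Arguments ds_map {_ _ _} _.

Variable D : dirsys.

Definition ds_sum : Type := {classic {n : nat & D n}}.
HB.instance Definition _ := Choice.on ds_sum.

Definition ds_eqv (x y : ds_sum) : bool :=
  `[< exists k (hx : (tag x <= k)%N) (hy : (tag y <= k)%N),
        ds_map hx (tagged x) = ds_map hy (tagged y) >].

Lemma ds_map_irr i j (h h' : (i <= j)%N) (x : D i) : ds_map h x = ds_map h' x.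
Proof. by rewrite (bool_irrelevance h h'). Qed.

Lemma ds_eqv_equiv : equiv_class_of ds_eqv.
Proof.
split=> [x|x y|y x z].
- by apply/asboolP; exists (tag x), (leqnn _), (leqnn _).
- by apply/asboolP/asboolP=> -[k [hx [hy e]]]; exists k, hy, hx.
move=> /asboolP[k [hx [hy e]]] /asboolP[l [hy' [hz e']]]; apply/asboolP.
have hk := leq_maxl k l; have hl := leq_maxr k l.
exists (maxn k l), (leq_trans hx hk), (leq_trans hz hl).
rewrite -(ds_map_comp hx hk) -(ds_map_comp hz hl) e -e'.
rewrite (ds_map_comp hy hk (leq_trans hy hk)).
by rewrite (ds_map_comp hy' hl (leq_trans hy hk)).
Qed.

Canonical ds_eqv_equivrel := EquivRelPack ds_eqv_equiv.
Canonical ds_eqv_encModRel := defaultEncModRel ds_eqv.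

(* The colimit is the quotient of the disjoint union of the [D n] identifying
   two elements when they become equal at some later stage. *)
Definition dirlim : Type := {eq_quot ds_eqv}.
HB.instance Definition _ := Choice.on dirlim.
HB.instance Definition _ := EqQuotient.on dirlim.

Definition dl_in n (x : D n) : dirlim :=
  \pi_dirlim (existT (fun n => D n : Type) n x : ds_sum).

Lemma dl_in_eqP m n (x : D m) (y : D n) : dl_in x = dl_in y <->
  exists k (hm : (m <= k)%N) (hn : (n <= k)%N), ds_map hm x = ds_map hn y.
Proof. by split=> [/eqmodP/asboolP|e] //; apply/eqmodP/asboolP. Qed.

Lemma dl_inP (x : dirlim) : exists n (y : D n), x = dl_in y.
Proof.
exists (tag (repr x)), (tagged (repr x)).
by rewrite /dl_in -[LHS]reprK; case: (repr x).
Qed.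

Lemma dl_in_map m n (h : (m <= n)%N) (x : D m) : dl_in (ds_map h x) = dl_in x.
Proof.
by apply/dl_in_eqP; exists n, (leqnn n), h; rewrite ds_map_id.
Qed.

Definition dl_zero : dirlim := dl_in (0 : D 0%N).
Definition dl_opp (x : dirlim) : dirlim := dl_in (- tagged (repr x)).
Definition dl_scale (a : R) (x : dirlim) : dirlim :=
  dl_in (a *: tagged (repr x)).
Definition dl_add (x y : dirlim) : dirlim :=
  dl_in (ds_map (leq_maxl (tag (repr x)) (tag (repr y))) (tagged (repr x))
       + ds_map (leq_maxr (tag (repr x)) (tag (repr y))) (tagged (repr y))).

Lemma dl_reprP n (x : D n) :
  exists k (h : (n <= k)%N) (h' : (tag (repr (dl_in x)) <= k)%N),
    ds_map h' (tagged (repr (dl_in x))) = ds_map h x.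
Proof.
have : dl_in (tagged (repr (dl_in x))) = dl_in x.
  by rewrite {2}/dl_in -[RHS]reprK; case: (repr _).
by move=> /dl_in_eqP[k [h' [h e]]]; exists k, h, h'.
Qed.

Lemma dl_oppE n (x : D n) : dl_opp (dl_in x) = dl_in (- x).
Proof.
have [k [h [h' e]]] := dl_reprP x.
by apply/dl_in_eqP; exists k, h', h; rewrite !linearN e.
Qed.

Lemma dl_scaleE a n (x : D n) : dl_scale a (dl_in x) = dl_in (a *: x).
Proof.
have [k [h [h' e]]] := dl_reprP x.
by apply/dl_in_eqP; exists k, h', h; rewrite !linearZ /= e.
Qed.

Lemma dl_addE n (x y : D n) : dl_add (dl_in x) (dl_in y) = dl_in (x + y).
Proof.
have [k [hx [hx' ex]]] := dl_reprP x; have [l [hy [hy' ey]]] := dl_reprP y.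
have hk := leq_maxl k l; have hl := leq_maxr k l.
have hm : (maxn (tag (repr (dl_in x))) (tag (repr (dl_in y))) <= maxn k l)%N.
  by rewrite geq_max (leq_trans hx' hk) (leq_trans hy' hl).
apply/dl_in_eqP; exists (maxn k l), hm, (leq_trans hx hk).
rewrite !linearD !(ds_map_comp _ _ (leq_trans hx' hk)).
rewrite !(ds_map_comp _ _ (leq_trans hy' hl)).
rewrite -(ds_map_comp hx' hk) ex -(ds_map_comp hy' hl) ey.
by rewrite (ds_map_comp _ _ (leq_trans hx hk)) (ds_map_comp _ _ (leq_trans hx hk)).
Qed.

Lemma dl_inP2 (x y : dirlim) :
  exists n (x' y' : D n), x = dl_in x' /\ y = dl_in y'.
Proof.
have [m [x' ->]] := dl_inP x; have [n [y' ->]] := dl_inP y.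
exists (maxn m n), (ds_map (leq_maxl m n) x'), (ds_map (leq_maxr m n) y').
by rewrite !dl_in_map.
Qed.

Lemma dl_inP3 (x y z : dirlim) :
  exists n (x' y' z' : D n), [/\ x = dl_in x', y = dl_in y' & z = dl_in z'].
Proof.
have [m [x' [y' [-> ->]]]] := dl_inP2 x y; have [n [z' ->]] := dl_inP z.
exists (maxn m n), (ds_map (leq_maxl m n) x'), (ds_map (leq_maxl m n) y'),
  (ds_map (leq_maxr m n) z').
by rewrite !dl_in_map.
Qed.

Lemma dl_in0 n : dl_in (0 : D n) = dl_zero.
Proof.
by apply/dl_in_eqP; exists n, (leqnn n), (leq0n n); rewrite !linear0.
Qed.

Fact dl_addA : associative dl_add.
Proof.
move=> x y z; have [n [a [b [c [-> -> ->]]]]] := dl_inP3 x y z.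
by rewrite !dl_addE addrA.
Qed.

Fact dl_addC : commutative dl_add.
Proof.
move=> x y; have [n [a [b [-> ->]]]] := dl_inP2 x y.
by rewrite !dl_addE addrC.
Qed.

Fact dl_add0 : left_id dl_zero dl_add.
Proof.
by move=> x; have [n [a ->]] := dl_inP x; rewrite -(dl_in0 n) dl_addE add0r.
Qed.

Fact dl_addN : left_inverse dl_zero dl_opp dl_add.
Proof.
move=> x; have [n [a ->]] := dl_inP x.
by rewrite dl_oppE dl_addE addNr dl_in0.
Qed.

HB.instance Definition _ :=
  GRing.isZmodule.Build dirlim dl_addA dl_addC dl_add0 dl_addN.

Fact dl_scalerA a b x : dl_scale a (dl_scale b x) = dl_scale (a * b) x.
Proof. by have [n [y ->]] := dl_inP x; rewrite !dl_scaleE scalerA. Qed.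

Fact dl_scale1r : left_id 1 dl_scale.
Proof. by move=> x; have [n [y ->]] := dl_inP x; rewrite dl_scaleE scale1r. Qed.

Fact dl_scalerDr : right_distributive dl_scale +%R.
Proof.
move=> a x y; have [n [u [v [-> ->]]]] := dl_inP2 x y.
by rewrite ![_ + _]dl_addE !dl_scaleE [RHS]dl_addE scalerDr.
Qed.

Fact dl_scalerDl x : {morph dl_scale^~ x : a b / a + b}.
Proof.
move=> a b; have [n [y ->]] := dl_inP x.
by rewrite !dl_scaleE [RHS]dl_addE scalerDl.
Qed.

HB.instance Definition _ := GRing.Zmodule_isLmodule.Build R dirlim
  dl_scalerA dl_scale1r dl_scalerDr dl_scalerDl.

Lemma dl_in_linear n : linear (@dl_in n).
Proof. by move=> a x y; rewrite -dl_addE -dl_scaleE. Qed.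

HB.instance Definition _ n :=
  GRing.isLinear.Build R (D n) dirlim *:%R (@dl_in n) (@dl_in_linear n).

End DirectLimit.

Arguments ds_map {_ _ _ _} _.

Section DirectLimitMap.
Variables (R : comNzRingType) (D D' : dirsys R).

Record dirsys_map := DirSysMap {
  dsm_fun :> forall n, {linear D n -> D' n};
  dsm_nat : forall i j (h : (i <= j)%N) x,
    dsm_fun j (ds_map h x) = ds_map h (dsm_fun i x) }.

Variable g : dirsys_map.

Definition dirlim_map (x : dirlim D) : dirlim D' :=
  dl_in (g _ (tagged (repr x))).

Lemma dirlim_mapE n (x : D n) : dirlim_map (dl_in x) = dl_in (g n x).
Proof.
have [k [h [h' e]]] := dl_reprP x.
by apply/dl_in_eqP; exists k, h', h; rewrite -!dsm_nat e.
Qed.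

Lemma dirlim_map_linear : linear dirlim_map.
Proof.
move=> a x y; have [n [u [v [-> ->]]]] := dl_inP2 x y.
by rewrite -linearP !dirlim_mapE !linearP.
Qed.

HB.instance Definition _ :=
  GRing.isLinear.Build R (dirlim D) (dirlim D') *:%R dirlim_map
    dirlim_map_linear.

End DirectLimitMap.

(* Not [idealr]: the unit ideal is allowed. *)
Definition ideal (R : comNzRingType) := submodule (R^o : lmodType R).

Section IdealProduct.
Variables (R : comNzRingType) (M : lmodType R).

Definition ideal_mul_pred (J : ideal R) (S : submodule M) : {pred M} :=
  fun x => `[< exists n (a : 'I_n -> R) (y : 'I_n -> M),
    [/\ forall i, a i \in submod_pred J, forall i, y i \in submod_pred S
      & x = \sum_(i < n) a i *: y i] >].

Lemma ideal_mul_closed J S : submod_closed (ideal_mul_pred J S).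
Proof.
split=> [|c x y /asboolP[m [a [u [aJ uS ->]]]] /asboolP[n [b [v [bJ vS ->]]]]].
  apply/asboolP; exists 0%N, (fun=> 0), (fun=> 0).
  by split=> [[]//|[]//|]; rewrite big_ord0.
apply/asboolP; exists (m + n)%N,
  (fun i => match fintype.split i with inl j => c * a j | inr j => b j end),
  (fun i => match fintype.split i with inl j => u j | inr j => v j end).
split=> [i|i|].
- by case: (fintype.split i) => j; [exact: (rpredZ c (aJ j)) | exact: bJ].
- by case: (fintype.split i).
rewrite big_split_ord /= scaler_sumr; congr (_ + _); apply: eq_bigr => i _.
  by rewrite (unsplitK (inl i)) scalerA.
by rewrite (unsplitK (inr i)).
Qed.

Definition ideal_mul (J : ideal R) (S : submodule M) : submodule M :=
  Submodule (ideal_mul_closed J S).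

End IdealProduct.

Section IdealTransform.
Variables (R : comNzRingType) (I : ideal R).

Fixpoint ideal_pow (n : nat) : ideal R :=
  if n is n'.+1 then ideal_mul I (ideal_pow n') else submod_full R^o.

Lemma ideal_pow_sub i j : (i <= j)%N ->
  {subset submod_pred (ideal_pow j) <= submod_pred (ideal_pow i)}.
Proof.
move=> /subnK <-; elim: (j - i)%N => [//|k IH] x /asboolP[n [a [y [_ yI ->]]]].
by apply: rpred_sum => l _; apply: (rpredZ (a l)); apply: IH; apply: yI.
Qed.

Variable M : lmodType R.

Definition ideal_pow_mod (n : nat) : submodule M :=
  ideal_mul (ideal_pow n) (submod_full M).

Lemma ideal_pow_mod_sub i j : (i <= j)%N ->
  {subset submod_pred (ideal_pow_mod j) <= submod_pred (ideal_pow_mod i)}.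
Proof.
move=> ij x /asboolP[n [a [y [aI yM ->]]]]; apply/asboolP; exists n, a, y.
by split=> // l; apply: (ideal_pow_sub ij); apply: aI.
Qed.

Definition ideal_pow_incl i j (ij : (i <= j)%N)
    (x : submod_type (ideal_pow_mod j)) : submod_type (ideal_pow_mod i) :=
  SubmodElt (ideal_pow_mod_sub ij (submod_valP x)).

Lemma ideal_pow_incl_linear i j (ij : (i <= j)%N) : linear (ideal_pow_incl ij).
Proof. by move=> a x y; apply: val_inj. Qed.

HB.instance Definition _ i j (ij : (i <= j)%N) :=
  GRing.isLinear.Build R (submod_type (ideal_pow_mod j))
    (submod_type (ideal_pow_mod i)) *:%R (ideal_pow_incl ij)
    (ideal_pow_incl_linear ij).

Section System.
Variable N : lmodType R.

Definition hom_pow (n : nat) : lmodType R :=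
  Hom (submod_type (ideal_pow_mod n)) N.

Definition hom_pow_res i j (ij : (i <= j)%N) (f : hom_pow i) : hom_pow j :=
  hom_of (hom_fun f \o ideal_pow_incl ij).

Lemma hom_pow_res_linear i j (ij : (i <= j)%N) : linear (hom_pow_res ij).
Proof. by move=> a f g; apply: hom_eqP. Qed.

HB.instance Definition _ i j (ij : (i <= j)%N) :=
  GRing.isLinear.Build R (hom_pow i) (hom_pow j) *:%R (hom_pow_res ij)
    (hom_pow_res_linear ij).

Lemma hom_pow_res_id i (h : (i <= i)%N) (f : hom_pow i) : hom_pow_res h f = f.
Proof.
by apply: hom_eqP => x /=; rewrite /hom_fun /=; congr (submod_val f _); apply: val_inj.
Qed.

Lemma hom_pow_res_comp i j k (ij : (i <= j)%N) (jk : (j <= k)%N)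
    (ik : (i <= k)%N) (f : hom_pow i) :
  hom_pow_res jk (hom_pow_res ij f) = hom_pow_res ik f.
Proof.
by apply: hom_eqP => x /=; rewrite /hom_fun /=; congr (submod_val f _); apply: val_inj.
Qed.

Definition hom_pow_sys : dirsys R :=
  @DirSys R hom_pow (fun i j ij => hom_pow_res ij) hom_pow_res_id
    hom_pow_res_comp.

Definition ideal_transform : lmodType R := dirlim hom_pow_sys.

End System.

Section Functoriality.
Variables (N N' : lmodType R) (f : {linear N -> N'}).

Definition hom_pow_post n (u : hom_pow N n) : hom_pow N' n :=
  hom_of (f \o hom_fun u).

Lemma hom_pow_post_linear n : linear (@hom_pow_post n).
Proof. by move=> a u v; apply: hom_eqP => x; rewrite /hom_fun /= linearP. Qed.

HB.instance Definition _ n :=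
  GRing.isLinear.Build R (hom_pow N n) (hom_pow N' n) *:%R (@hom_pow_post n)
    (@hom_pow_post_linear n).

Lemma hom_pow_post_nat i j (ij : (i <= j)%N) (u : hom_pow_sys N i) :
  hom_pow_post (ds_map ij u) = ds_map ij (hom_pow_post u : hom_pow_sys N' i).
Proof. exact: hom_eqP. Qed.

Definition hom_pow_sys_map : dirsys_map (hom_pow_sys N) (hom_pow_sys N') :=
  @DirSysMap R (hom_pow_sys N) (hom_pow_sys N') (fun n => @hom_pow_post n)
    hom_pow_post_nat.

Definition ideal_transform_map :
    {linear ideal_transform N -> ideal_transform N'} :=
  dirlim_map hom_pow_sys_map.

End Functoriality.
End IdealTransform.

Section Cohomology.
Variables (R : comNzRingType) (C : nat -> lmodType R).
Variable d : forall n, {linear C n -> C n.+1}.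

Definition cocycle_pred n : {pred C n} := fun x => d n x == 0.

Lemma cocycle_closed n : submod_closed (@cocycle_pred n).
Proof.
split=> [|a x y /eqP dx /eqP dy]; apply/eqP; first exact: linear0.
by rewrite linearP dx dy scaler0 addr0.
Qed.

Definition cocycles n : submodule (C n) := Submodule (@cocycle_closed n).

Definition is_boundary n : C n -> Prop :=
  if n is m.+1 then fun x => exists y, x = d m y else fun x => x = 0.

Definition coboundary_pred n : {pred submod_type (cocycles n)} :=
  fun z => `[< is_boundary (submod_val z) >].

Lemma coboundary_closed n : submod_closed (@coboundary_pred n).
Proof.
case: n => [|n]; split=> [|a x y].
- exact/asboolP.
- move=> /asboolP/= ex /asboolP/= ey; apply/asboolP => /=.
  by rewrite ex ey scaler0 addr0.
- by apply/asboolP; exists 0; rewrite linear0.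
move=> /asboolP[u ex] /asboolP[v ey]; apply/asboolP => /=.
by exists (a *: u + v); rewrite linearP -ex -ey.
Qed.

Definition coboundaries n : submodule (submod_type (cocycles n)) :=
  Submodule (@coboundary_closed n).

Definition cohomology n : lmodType R := quotmod (coboundaries n).

End Cohomology.

Definition injective_module (R : comNzRingType) (E : lmodType R) : Prop :=
  forall (U V : lmodType R) (f : {linear U -> V}) (g : {linear U -> E}),
    injective f -> exists h : {linear V -> E}, forall x, h (f x) = g x.

Record injective_resolution (R : comNzRingType) (N : lmodType R) := InjRes {
  ir_obj :> nat -> lmodType R;
  ir_aug : {linear N -> ir_obj 0%N};
  ir_diff : forall n, {linear ir_obj n -> ir_obj n.+1};
  ir_injective : forall n, injective_module (ir_obj n);
  ir_aug_inj : injective ir_aug;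
  ir_exact0 : forall x, ir_diff 0%N x = 0 <-> exists y, x = ir_aug y;
  ir_exact : forall n x,
    ir_diff n.+1 x = 0 <-> exists y, x = ir_diff n y }.

(* The value at [N] of the [i]-th right derived functor of the additive functor
   given by [F] and [Fmap], computed on the injective resolution [E]; up to
   isomorphism it does not depend on [E]. *)
Definition right_derived (R : comNzRingType) (F : lmodType R -> lmodType R)
    (Fmap : forall U V : lmodType R, {linear U -> V} -> {linear F U -> F V})
    (N : lmodType R) (E : injective_resolution N) (i : nat) : lmodType R :=
  cohomology (fun n => Fmap _ _ (ir_diff E n)) i.

Definition derived_ideal_transform (R : comNzRingType) (I : ideal R)
    (M N : lmodType R) (E : injective_resolution N) (i : nat) : lmodType R :=
  right_derived (@ideal_transform_map R I M) E i.

Section Finiteness.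
Variable R : comNzRingType.

Definition finitely_generated (M : lmodType R) : Prop :=
  exists n (g : 'I_n -> M), forall x : M,
    exists c : 'I_n -> R, x = \sum_(i < n) c i *: g i.

Definition noetherian_ring : Prop :=
  forall J : ideal R, finitely_generated (submod_type J).

Definition prime_ideal (P : ideal R) : Prop :=
  (1 : R) \notin submod_pred P /\
  prime_idealr_closed (submod_pred P : {pred R}).

Definition associated_primes (X : lmodType R) : set (ideal R) :=
  [set P | prime_ideal P /\
    exists x : X, forall r : R, (r \in submod_pred P) = (r *: x == 0)].

Definition weakly_laskerian (X : lmodType R) : Prop :=
  forall S : submodule X, finite_set (associated_primes (quotmod S)).

End Finiteness.

(* Main.v *)
Require Import Defs.
From HB Require Import structures.
From mathcomp Require Import all_boot all_order all_algebra.
From mathcomp Require Import generic_quotient ring_quotient.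
From mathcomp Require Import boolp classical_sets functions cardinality.
Set Implicit Arguments.
Unset Strict Implicit.
Unset Printing Implicit Defensive.
Import GRing.Theory.
Local Open Scope ring_scope.
Local Open Scope classical_set_scope.

(* Let [J^i = D_I(E^i)]; the quotient map [E^i -> J^i] is onto with kernel the
   [I]-torsion of [E^i], and by Artin-Rees [J] is a complex of modules injective
   for finitely generated modules, without [I]-torsion, with
   [D_I(M, E) = Hom(M, J)].  Modulo weakly Laskerian modules the groups
   [Ext^p(M, Z^i(J))], [p > 0], [i < t], vanish, by induction on [i].  Hence so
   do
   - the kernel of [H^t(Hom(M, J)) -> Hom(M, H^t(J))], which reduces the claim
     to the finiteness of [Ass(H^t(J))], and
   - for [t > 0], the module [Hom(R/I, H^t(J))], because [Hom(R/I, J) = 0].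
   For [t > 0] every associated prime of [H^t(J)] contains [I], as [H^t(J)] is
   [I]-torsion; for [t = 0], [Ass(H^0(J))] embeds in the associated primes of
   [N] modulo its [I]-torsion. *)

(** * Submodules as propositional subsets, and linear relations *)

Section LinearSubset.
Variable R : comNzRingType.

Definition linear_subset (V : lmodType R) (S : set V) : Prop :=
  S 0 /\ forall a x y, S x -> S y -> S (a *: x + y).

Section Theory.
Variables (V : lmodType R) (S : set V).
Hypothesis SL : linear_subset S.

Lemma linear_subset0 : S 0. Proof. by case: SL. Qed.

Lemma linear_subsetZ a x : S x -> S (a *: x).
Proof. by move=> Sx; rewrite -[_ *: _]addr0; apply: SL.2 => //; case: SL. Qed.

Lemma linear_subsetD x y : S x -> S y -> S (x + y).
Proof. by move=> Sx Sy; rewrite -[x]scale1r; apply: SL.2. Qed.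

Lemma linear_subsetN x : S x -> S (- x).
Proof. by move=> Sx; rewrite -scaleN1r; apply: linear_subsetZ. Qed.

Lemma linear_subsetB x y : S x -> S y -> S (x - y).
Proof. by move=> Sx Sy; apply/linear_subsetD => //; apply: linear_subsetN. Qed.

Lemma linear_subset_sum n (F : 'I_n -> V) :
  (forall i, S (F i)) -> S (\sum_(i < n) F i).
Proof.
by move=> SF; elim/big_ind: _ => //; [exact: linear_subset0 | exact:
  linear_subsetD].
Qed.

Lemma linear_subset_closed : submod_closed (fun x => `[< S x >] : bool).
Proof.
split=> [|a x y /asboolP Sx /asboolP Sy]; apply/asboolP.
  exact: linear_subset0.
exact: SL.2.
Qed.

Definition submodule_of : submodule V := Submodule linear_subset_closed.

Lemma submodule_ofP x : reflect (S x) (x \in submod_pred submodule_of).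
Proof. exact: asboolP. Qed.

End Theory.

Definition sum_set (V : lmodType R) (S T : set V) : set V :=
  [set x | exists s t, [/\ S s, T t & x = s + t]].

Lemma linear_subset_add (V : lmodType R) (S T : set V) :
  linear_subset S -> linear_subset T -> linear_subset (sum_set S T).
Proof.
move=> SL TL; split.
  by exists 0, 0; split; [exact: linear_subset0|exact: linear_subset0|
    by rewrite addr0].
move=> a _ _ [s [t [Ss Tt ->]]] [s' [t' [Ss' Tt' ->]]].
exists (a *: s + s'), (a *: t + t'); split; [exact: SL.2|exact: TL.2|].
by rewrite scalerDr addrACA.
Qed.

Lemma sum_setl (V : lmodType R) (S T : set V) :
  linear_subset T -> S `<=` sum_set S T.
Proof.
by move=> TL x Sx; exists x, 0; split=> //;
  [exact: linear_subset0|rewrite addr0].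
Qed.

Lemma sum_setr (V : lmodType R) (S T : set V) :
  linear_subset S -> T `<=` sum_set S T.
Proof.
by move=> SL x Tx; exists 0, x; split=> //;
  [exact: linear_subset0|rewrite add0r].
Qed.

(** A submodule of the product of [V] and [W], seen as a partial multivalued linear map; it
    describes connecting maps without choosing lifts. *)
Definition linear_rel (V W : lmodType R) (rho : V -> W -> Prop) : Prop :=
  rho 0 0 /\ forall a x y x' y',
    rho x y -> rho x' y' -> rho (a *: x + x') (a *: y + y').

End LinearSubset.

(** * Relative weakly Laskerian modules *)

Section RelativeAssociatedPrimes.
Variable R : comNzRingType.

Lemma ideal_mulr (P : ideal R) (r q : R) :
  q \in submod_pred P -> r * q \in submod_pred P.
Proof. exact: (@rpredZ _ _ (submod_pred P) r q). Qed.

Lemma prime_ideal_prod (P : ideal R) n (r : 'I_n -> R) : prime_ideal P ->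
  (forall i, r i \notin submod_pred P) ->
  \prod_(i < n) r i \notin submod_pred P.
Proof.
move=> [P1 Pm] rP; elim/big_ind: _ => // x y xP yP.
by apply/negP => /Pm; rewrite (negPf xP) (negPf yP).
Qed.

Lemma prime_ideal_exp (P : ideal R) a n : prime_ideal P ->
  a \notin submod_pred P -> a ^+ n \notin submod_pred P.
Proof.
move=> PP aP; rewrite -[n]card_ord -prodr_const.
exact: (prime_ideal_prod PP).
Qed.

(* For submodules [A] and [S], these are the associated primes of
   [(A + S) / S]. *)
Definition rel_ass (V : lmodType R) (A S : set V) : set (ideal R) :=
  [set P | prime_ideal P /\
     exists2 x, A x & forall r, (r \in submod_pred P) <-> S (r *: x)].

(* The quotient [(A + B) / B] is weakly Laskerian. *)
Definition rel_wl (V : lmodType R) (A B : set V) : Prop :=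
  forall S, linear_subset S -> B `<=` S -> finite_set (rel_ass A S).

Lemma quotmod_pi_eq0 (X : lmodType R) (S : submodule X) (x : X) :
  (\pi_(quotmod S)%qT x = 0) <-> (x \in submod_pred S).
Proof.
have -> : (0 : quotmod S) = (\pi_(quotmod S) 0)%qT.
  by apply: (addIr (\pi_(quotmod S) 0)%qT); rewrite add0r -quotmod_piD addr0.
by split=> [/quotmod_eqP|]; [|move=> xS; apply/quotmod_eqP]; rewrite subr0.
Qed.

Lemma weakly_laskerian_rel (X : lmodType R) :
  weakly_laskerian X -> rel_wl [set: X] [set 0].
Proof.
move=> Xwl S SL _; apply: sub_finite_set (Xwl (submodule_of SL)).
move=> P [PP [x _ xP]]; split=> //.
exists (\pi_(quotmod (submodule_of SL))%qT x) => r.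
rewrite -[_ *: _]quotmod_pi_scale; apply/idP/eqP.
  by move=> /xP/(submodule_ofP SL)/quotmod_pi_eq0.
by move=> /quotmod_pi_eq0/(submodule_ofP SL)/xP.
Qed.

(** Let [P] be the annihilator of [x] modulo [S]. If some [r] outside [P] brings [x] into [B + S],
    the [B]-component of [r *: x] also has annihilator [P] modulo [S]; otherwise [x] has annihilator
    [P] modulo [B + S]. Hence extensions of weakly Laskerian modules are weakly Laskerian. *)
Lemma rel_wl_trans (V : lmodType R) (A B C : set V) : linear_subset B ->
  rel_wl A B -> rel_wl B C -> rel_wl A C.
Proof.
move=> BL AB BC S SL CS.
have SBL := linear_subset_add BL SL.
apply: (@sub_finite_set _ _ (rel_ass B S `|` rel_ass A (sum_set B S)));
  last first.
  rewrite finite_setU; split; first exact: BC.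
  by apply: AB => //; apply: sum_setl.
move=> P [PP [x Ax xP]].
have [[r rP [b [s [Bb Ss e]]]]|nr] :=
    pselect (exists2 r, r \notin submod_pred P & sum_set B S (r *: x)).
  left; split=> //; exists b => // q.
  have -> : b = r *: x - s by rewrite e addrK.
  rewrite scalerBr scalerA; split=> [qP|Sq].
    apply: (linear_subsetB SL); last exact: linear_subsetZ.
    by apply/xP; rewrite mulrC; apply: ideal_mulr.
  have /xP : S ((q * r) *: x).
    by rewrite -[_ *: x](subrK (q *: s)); apply: linear_subsetD => //;
      apply: linear_subsetZ.
  by move=> /PP.2/orP[//|rP']; rewrite rP' in rP.
right; split=> //; exists x => // r; split=> [/xP Srx|Hr].
  exact: (sum_setr BL).
by apply/negPn/negP => rP; apply: nr; exists r.
Qed.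

(* [(A + B) / B] is a subquotient of [(A' + B') / B'] through [rho]. *)
Lemma rel_wl_linear_rel (V W : lmodType R) (rho : V -> W -> Prop)
    (A B : set V) (A' B' : set W) :
  linear_rel rho -> linear_subset B' ->
  (forall x, A x -> exists2 y, A' y & rho x y) ->
  (forall x y, rho x y -> B' y -> B x) ->
  rel_wl A' B' -> rel_wl A B.
Proof.
move=> [r0 rD] BL' AA BB wl S SL BS.
(* Modulo [B' + T], a partner [y] of [x] has the annihilator that [x] has modulo [S]. *)
pose T := [set y | exists2 s, S s & rho s y].
have TL : linear_subset T.
  split; first by exists 0 => //; exact: linear_subset0.
  move=> a y y' [s Ss ry] [s' Ss' ry']; exists (a *: s + s'); first exact: SL.2.
  exact: rD.
have SBL := linear_subset_add BL' TL.
apply: sub_finite_set (wl _ SBL (sum_setl TL)).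
move=> P [PP [x Ax xP]]; split=> //; have [y Ay xy] := AA x Ax.
have rZ a : rho (a *: x) (a *: y).
  by rewrite -[_ *: x]addr0 -[_ *: y]addr0; apply: rD.
exists y => // r; split=> [/xP Srx|].
  by apply: (sum_setr BL'); exists (r *: x).
move=> [b [u [Bb [s Ss su] e]]]; apply/xP.
rewrite -[r *: x](subrK s); apply: linear_subsetD => //; apply: BS.
apply: (BB _ b) => //.
have := rD (-1) _ _ _ _ su (rZ r).
by rewrite !scaleN1r addrC e [- u + _]addrC addrK.
Qed.

Lemma rel_wlS (V : lmodType R) (A B A' B' : set V) :
  linear_subset A -> linear_subset B' ->
  A `<=` A' -> A `&` B' `<=` B -> rel_wl A' B' -> rel_wl A B.
Proof.
move=> AL BL' AA BB; apply: (rel_wl_linear_rel (rho := fun x y => A x /\ x =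
  y)) BL' _ _.
- split; first by split=> //; exact: AL.1.
  by move=> a x _ x' _ [Ax <-] [Ax' <-]; split=> //; exact: AL.2.
- by move=> x Ax; exists x; [exact: AA|].
- by move=> x _ [Ax <-] Bx; apply: BB.
Qed.

Lemma rel_wl_refl (V : lmodType R) (A : set V) : rel_wl A A.
Proof.
move=> S SL AS; suff -> : rel_ass A S = set0 by exact: finite_set0.
apply/seteqP; split=> // P [[P1 _] [x Ax xP]].
by move/negP: P1; apply; apply/xP; rewrite scale1r; apply: AS.
Qed.

Definition power_set n (V : lmodType R) (S : set V) : set ('I_n -> V) :=
  [set e | forall i, S (e i)].

Lemma power_set_linear n (V : lmodType R) (S : set V) :
  linear_subset S -> linear_subset (power_set (n := n) S).
Proof.
move=> SL; split=> [i|a e e' Se Se' i]; first exact: (linear_subset0 SL).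
exact: SL.2.
Qed.

(** Filter by the vectors whose first [k] entries lie in [B]: each step of the filtration embeds in
    [(A + B) / B] through the entry of index [k]. *)
Lemma rel_wl_power n (V : lmodType R) (A B : set V) :
  linear_subset A -> linear_subset B ->
  rel_wl A B -> rel_wl (power_set (n := n) A) (power_set B).
Proof.
move=> AL BL AB.
have AnL := power_set_linear n AL.
pose C k := [set e : 'I_n -> V | power_set A e /\ forall i : 'I_n,
  (i < k)%N -> B (e i)].
have CL k : linear_subset (C k).
  split=> [|a e e' [Ae Be] [Ae' Be']]; split.
  - exact: (power_set_linear n AL).1.
  - by move=> i _; apply: (linear_subset0 BL).
  - exact: (power_set_linear n AL).2.
  - by move=> i ik; apply: BL.2; [apply: Be|apply: Be'].
suff CC k : (k <= n)%N -> rel_wl (power_set A) (C k).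
  by apply: (rel_wlS AnL (CL n) _ _ (CC n (leqnn n))) => // e [_ [_ Be]] i;
    exact: Be.
elim: k => [_|k IH kn].
  by apply: (rel_wlS AnL AnL _ _ (@rel_wl_refl _ (power_set A))) => // e [].
apply: rel_wl_trans (CL k) (IH (ltnW kn)) _.
pose i0 := Ordinal kn.
pose rho (e : 'I_n -> V) (x : V) := C k e /\ x = e i0.
apply: (@rel_wl_linear_rel _ _ rho _ _ A B _ BL _ _ AB).
- split; first by split=> //; exact: (CL k).1.
  by move=> a e x e' x' [Ce ->] [Ce' ->]; split=> //; exact: (CL k).2.
- by move=> e Ce; exists (e i0) => //; exact: Ce.1.
move=> e x [[Ae Be] ->] Bx; split=> // i;
  rewrite ltnS leq_eqVlt => /orP[/eqP ik|].
  by have -> : i = i0 by apply: val_inj.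
exact: Be.
Qed.

End RelativeAssociatedPrimes.

(** * The Artin-Rees lemma *)

Lemma scalerCA (R : comNzRingType) (V : lmodType R) a b (x : V) :
  a *: (b *: x) = b *: (a *: x).
Proof. by rewrite !scalerA mulrC. Qed.

Lemma submod_val_sum (R : comNzRingType) (V : lmodType R) (S : submodule V)
    n (c : 'I_n -> R) (x : 'I_n -> submod_type S) :
  submod_val (\sum_(i < n) c i *: x i) = \sum_(i < n) c i *: submod_val (x i).
Proof. by elim/big_rec2: _ => // i _ y _ <-. Qed.

Section NoetherianRows.
Variable R : comNzRingType.
Hypothesis R_noetherian : noetherian_ring R.

Lemma noetherian_ideal_gens (S : set R^o) : linear_subset S ->
  exists n (g : 'I_n -> R), (forall i, S (g i)) /\
    forall x, S x -> exists c : 'I_n -> R, x = \sum_(i < n) c i * g i.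
Proof.
move=> SL; have [n [g gP]] := R_noetherian (submodule_of SL).
exists n, (fun i => submod_val (g i)); split=> [i|x Sx].
  exact/(submodule_ofP SL)/submod_valP.
have xS : (x : R^o) \in submod_pred (submodule_of SL) by apply/submodule_ofP.
have [c /(congr1 (@submod_val _ _ _)) e] := gP (SubmodElt xS).
by rewrite submod_val_sum in e; exists c.
Qed.

(** Induction on [n]: the leading entries form a finitely generated ideal, and subtracting lifts of
    its generators leaves a row with leading entry zero, that is, a shorter row. *)
Lemma noetherian_rows n (S : set 'rV[R]_n) : linear_subset S ->
  exists m (A : 'M[R]_(m, n)), forall x, S x <-> exists c : 'rV_m, x = c *m A.
Proof.
elim: n S => [|n IH] S SL.
  exists 0%N, 0 => x; split=> _; first by exists 0; apply/matrixP=> ? [].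
  by rewrite (_ : x = 0); [exact: linear_subset0|apply/matrixP=> ? []].
pose S0 : set R^o := [set a | exists2 x, S x & x 0 0 = a].
have S0L : linear_subset S0.
  split; first by exists 0; [exact: linear_subset0|rewrite mxE].
  move=> a _ _ [x Sx <-] [y Sy <-]; exists (a *: x + y); first exact: SL.2.
  by rewrite !mxE.
have [p [g [gS gP]]] := noetherian_ideal_gens S0L.
have /choice [G GP] : forall i, exists x, S x /\ x 0 0 = g i.
  by move=> i; have [x] := gS i; exists x.
pose S1 : set 'rV_n := [set y | S (row_mx (0 : 'M_1) y)].
have S1L : linear_subset S1.
  split; first by rewrite /S1 /= row_mx0; exact: linear_subset0.
  move=> a x y Sx Sy; rewrite /S1 /=.
  have -> : row_mx (0 : 'M[R]_1) (a *: x + y) = a *: row_mx 0 x + row_mx 0 y.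
    by rewrite scale_row_mx add_row_mx scaler0 addr0.
  exact: SL.2.
have [q [A1 A1P]] := IH S1 S1L.
have comb (c : 'rV_p) : S (c *m \matrix_(i < p) G i).
  rewrite mulmx_sum_row; apply: linear_subset_sum => // i.
  by apply: linear_subsetZ => //; rewrite rowK; have [] := GP i.
have mul0A (c : 'rV_q) :
    c *m row_mx (0 : 'M_(q, 1)) A1 = row_mx (0 : 'M_1) (c *m A1).
  by rewrite mul_mx_row mulmx0.
exists (p + q)%N, (col_mx (\matrix_(i < p) G i) (row_mx (0 : 'M_(q,
  1)) A1)) => x; split.
  move=> Sx; have [|c xc] := gP (x 0 0); first by exists x.
  pose cv := \row_i c i.
  pose y : 'rV_(1 + n) := x - cv *m \matrix_(i < p) G i.
  have Sy : S y by apply: linear_subsetB => //; exact: comb.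
  have y0 : lsubmx y = 0.
    apply/matrixP=> i j; rewrite !ord1 !mxE.
    rewrite (_ : lshift n (0 : 'I_1) = 0 :> 'I_n.+1); last exact: val_inj.
    rewrite xc; apply/eqP; rewrite subr_eq0; apply/eqP.
    by apply: eq_bigr => k _; rewrite !mxE; have [_ ->] := GP k.
  have [c' yc'] : exists c' : 'rV_q, rsubmx y = c' *m A1.
    by apply/A1P; rewrite /S1 /= -y0 hsubmxK.
  exists (row_mx cv c'); rewrite mul_row_col [X in _ + X]mul0A -yc' -y0 hsubmxK.
  by rewrite /y addrC subrK.
move=> [c ->]; rewrite -[c]hsubmxK mul_row_col [X in _ + X]mul0A.
apply: linear_subsetD => //; apply/A1P; by exists (rsubmx c).
Qed.

(** The union of the chain is generated by the rows of one matrix, and these already lie in a common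
    stage. *)
Lemma noetherian_chain n (S : nat -> set 'rV[R]_n) :
  (forall k, linear_subset (S k)) -> (forall k, S k `<=` S k.+1) ->
  exists k, forall l, S l `<=` S k.
Proof.
move=> SL Sinc.
have mono k l : (k <= l)%N -> S k `<=` S l.
  by move=> /subnK <-; elim: (l - k)%N => [//|j IH] x /IH; rewrite addSn;
    exact: Sinc.
have UL : linear_subset (\bigcup_k S k).
  split; first by exists 0%N => //; exact: linear_subset0.
  move=> a x y [k _ Sx] [l _ Sy]; exists (maxn k l) => //.
  by apply: (SL _).2; [apply: mono Sx; exact: leq_maxl|apply: mono Sy;
    exact: leq_maxr].
have [m [A AP]] := noetherian_rows UL.
have /choice [K KP] : forall i, exists k, S k (row i A).
  move=> i; have [|k _ Sk] := (AP (row i A)).2; last by exists k.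
  by exists (delta_mx 0 i); rewrite -rowE.
exists (\max_i K i) => l x Sx.
have [|c ->] := (AP x).1; first by exists l.
rewrite mulmx_sum_row; apply: (linear_subset_sum (SL _)) => i.
by apply: (linear_subsetZ (SL _)); apply: mono (KP i); exact: leq_bigmax.
Qed.

Section ArtinRees.
Variable I : ideal R.

Definition pow_ideal n : set R := [set r | r \in submod_pred (ideal_pow I n)].

Lemma pow_ideal_mono m n : (m <= n)%N -> pow_ideal n `<=` pow_ideal m.
Proof. by move=> mn r; apply: ideal_pow_sub. Qed.

Lemma pow_idealM n a r : a \in submod_pred I -> pow_ideal n r ->
  pow_ideal n.+1 (a * r).
Proof.
move=> aI rn; apply/asboolP; exists 1%N, (fun=> a), (fun=> r); split=> //.
by rewrite big_ord1.
Qed.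

Lemma pow_ideal_exp n a : a \in submod_pred I -> pow_ideal n (a ^+ n).
Proof.
by move=> aI; elim: n => [//|n IH]; rewrite exprS; apply: pow_idealM.
Qed.

Lemma ideal_gens : exists m (g : 'I_m -> R),
  (forall i, g i \in submod_pred I) /\
  forall x, x \in submod_pred I ->
    exists c : 'I_m -> R, x = \sum_(i < m) c i * g i.
Proof.
apply: (@noetherian_ideal_gens [set r | r \in submod_pred I]).
by split=> [|a x y xI yI]; [exact: rpred0|apply: rpredD => //; exact: rpredZ].
Qed.

(** The finitely many generators of [I] share one exponent; its successor pays for the factor in [I]
    itself. *)
Lemma pow_ideal_colon (V : lmodType R) (S : set V) (x : V) :
  linear_subset S ->
  (forall a, a \in submod_pred I -> exists n, forall r, pow_ideal n r ->
    S (r *: (a *: x))) ->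
  exists n, forall r, pow_ideal n r -> S (r *: x).
Proof.
move=> SL Sa; have [m [g [gI gP]]] := ideal_gens.
have /choice [K KP] : forall i, exists n, forall r, pow_ideal n r ->
  S (r *: (g i *: x)).
  by move=> i; apply: Sa.
exists (\max_i K i).+1 => r /asboolP[l [a [y [aI yI ->]]]].
rewrite scaler_suml; apply: linear_subset_sum => // j.
have [c ac] := gP _ (aI j).
have -> : (a j *: y j : R) *: x = (y j : R) *: (a j *: x).
  by rewrite scalerA; congr (_ *: _); exact: mulrC.
rewrite ac scaler_suml scaler_sumr.
apply: linear_subset_sum => // i.
rewrite -scalerA scalerCA; apply: linear_subsetZ => //.
by apply: KP; apply: pow_ideal_mono (yI j); exact: leq_bigmax.
Qed.

(** Induction on the sum of the exponents: unless some exponent is zero, each [g i *: x] satisfies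
    the hypothesis with [e i] lowered by one, and [pow_ideal_colon] combines the results. *)
Lemma pow_ideal_colon_gens (V : lmodType R) (S : set V) (x : V)
    m (g : 'I_m -> R) (e : 'I_m -> nat) :
  (forall a, a \in submod_pred I ->
    exists c : 'I_m -> R, a = \sum_(i < m) c i * g i) ->
  linear_subset S -> (forall i, S (g i ^+ e i *: x)) ->
  exists n, forall r, pow_ideal n r -> S (r *: x).
Proof.
move=> gP SL; move: {2}(\sum_i e i)%N (leqnn (\sum_i e i)%N) => N.
elim: N e x => [|N IH] e x eN Sx.
  apply: pow_ideal_colon => // a /gP[c ->]; exists 0%N => r _.
  rewrite scaler_suml; apply: linear_subsetZ => //;
    apply: linear_subset_sum => // i.
  have := Sx i; suff -> : e i = 0%N.
    by rewrite scale1r => xS; apply: linear_subsetZ.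
  by apply/eqP; rewrite -leqn0 (leq_trans _ eN) // (bigD1 i) //= leq_addr.
have [/existsP[i /eqP ei]|/existsPn e0] := boolP [exists i, e i == 0%N].
  exists 0%N => r _; apply: linear_subsetZ => //.
  by have := Sx i; rewrite ei scale1r.
suff Sg i : exists n, forall r, pow_ideal n r -> S (r *: (g i *: x)).
  have /choice [K KP] := Sg.
  apply: pow_ideal_colon => // a /gP[c ->]; exists (\max_i K i) => r rn.
  rewrite scaler_suml scaler_sumr; apply: linear_subset_sum => // i.
  rewrite -scalerA scalerCA; apply: linear_subsetZ => //.
  by apply: KP; apply: pow_ideal_mono rn; exact: leq_bigmax.
pose e' j := (e j - (j == i))%N.
apply: (IH e').
  have : (\sum_j e j = \sum_j e' j + 1)%N.
    rewrite (bigD1 i) //= [in RHS](bigD1 i) //= /e' eqxx.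
    rewrite [in RHS](eq_bigr e) => [|j /negPf ->]; last by rewrite subn0.
    by rewrite addnAC subnK // lt0n.
  by move=> Ee; move: eN; rewrite Ee addn1 ltnS.
move=> j; rewrite scalerA mulrC /e'; have [->|_] := eqVneq j i.
  by rewrite -exprS subn1 prednK ?lt0n.
by rewrite subn0 -scalerA; apply: linear_subsetZ.
Qed.

(** Take [U' = U + a ^+ k F], with [F] the free module and [k] the stage where the chain of the
    [C k] stops. If [u + a ^+ k *: z] is in [S], multiplying by [a ^+ N] puts [z] in [C (N + k)],
    which is contained in [C k]; so [a ^+ k *: z] is in [U]. *)
Lemma artin_rees_step n (S U : set 'rV[R]_n) N a :
  linear_subset S -> linear_subset U -> a \in submod_pred I ->
  (forall r x, pow_ideal N r -> S x -> U (r *: x)) ->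
  exists U' : set 'rV_n, [/\ linear_subset U', U `<=` U',
    U' `&` S `<=` U `&` S & exists k, forall x, U' (a ^+ k *: x)].
Proof.
move=> SL UL aI NU.
pose C k : set 'rV_n := [set x | U (a ^+ k *: x)].
have CL k : linear_subset (C k).
  split=> [|b x y Cx Cy]; first by rewrite /C /= scaler0; exact: linear_subset0.
  by rewrite /C /= scalerDr scalerCA; apply: UL.2.
have Cinc k : C k `<=` C k.+1.
  by move=> x Cx; rewrite /C /= exprS -scalerA; apply: linear_subsetZ.
have [k kP] := noetherian_chain CL Cinc.
pose T : set 'rV_n := [set x | exists z, x = a ^+ k *: z].
have TL : linear_subset T.
  split; first by exists 0; rewrite scaler0.
  move=> b _ _ [z ->] [z' ->]; exists (b *: z + z').
  by rewrite scalerDr scalerCA.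
exists (sum_set U T); split.
- exact: linear_subset_add.
- exact: sum_setl.
- move=> _ [[u [_ [Uu [z ->] ->]]] Sy]; split=> //.
  apply: linear_subsetD => //; apply: (kP (N + k)%N);
    rewrite /C /= exprD -scalerA.
  have -> : a ^+ N *: (a ^+ k *: z) = a ^+ N *: (u + a ^+ k *: z) - a ^+ N *: u.
    by rewrite -scalerBr [u + _]addrC addrK.
  apply: linear_subsetB => //; last exact: linear_subsetZ.
  by apply: NU => //; exact: pow_ideal_exp.
by exists k => x; apply: sum_setr => //; exists x.
Qed.

(* Weak Artin-Rees lemma: [I ^ k F] meets [S] inside [I ^ N S], hence inside
   any [U] containing the latter. *)
Lemma artin_rees n (S U : set 'rV[R]_n) N :
  linear_subset S -> linear_subset U ->
  (forall r x, pow_ideal N r -> S x -> U (r *: x)) ->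
  exists k, forall x : 'rV_n, (forall j, pow_ideal k (x 0 j)) -> S x -> U x.
Proof.
move=> SL UL NU; have [m [g [gI gP]]] := ideal_gens.
have [U' [UL' US UP]] : exists U' : set 'rV_n, [/\ linear_subset U',
    U' `&` S `<=` U & forall i, exists k, forall x, U' (g i ^+ k *: x)].
  suff H (s : seq 'I_m) : exists U' : set 'rV_n, [/\
      linear_subset U', U `<=` U',
      U' `&` S `<=` U & forall i, i \in s ->
        exists k, forall x, U' (g i ^+ k *: x)].
    have [U' [H1 _ H3 H4]] := H (enum 'I_m); exists U'; split=> // i.
    by apply: H4; rewrite mem_enum.
  (* The set grows by one generator at a time: its trace on [S] stays in [U], and the hypothesis on
     [N] persists. *)
  elim: s => [|i s [U' [UL' UU US UP]]]; first by exists U; split=> // x [].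
  have NU' r x : pow_ideal N r -> S x -> U' (r *: x).
    by move=> rN Sx; apply: UU; apply: NU.
  have [U2 [UL2 UU2 US2 UP2]] := artin_rees_step SL UL' (gI i) NU'.
  exists U2; split=> //; first exact: subset_trans UU2.
    by move=> x /US2; apply: US.
  move=> j; rewrite inE => /orP[/eqP ->//|/UP[k kP]].
  by exists k => x; apply/UU2/kP.
have /choice [e eP] := UP.
have key j : exists k, forall r, pow_ideal k r -> U' (r *: delta_mx 0 j).
  by apply: (pow_ideal_colon_gens (e := e) gP).
have /choice [K KP] := key.
exists (\max_j K j)%N => x xk Sx; apply: US; split=> //.
rewrite [x]row_sum_delta; apply: linear_subset_sum => // j.
by apply: KP; apply: pow_ideal_mono (xk j); exact: leq_bigmax.
Qed.

End ArtinRees.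
End NoetherianRows.

(** * Linear systems and extension groups *)

Lemma linear_subsetT (R : comNzRingType) (V : lmodType R) :
  linear_subset [set: V].
Proof. by []. Qed.

Section LinearSystems.
Variable R : comNzRingType.

(** A tuple [e] stands for the linear map from [R^n] to [V] with these values on the basis;
    [dot x e] is its value at [x], and [mxact] below composes it with [A]. *)
Definition dot (V : lmodType R) n (x : 'rV[R]_n) (e : 'I_n -> V) : V :=
  \sum_(j < n) x 0 j *: e j.

Definition mxact (V : lmodType R) m n (A : 'M[R]_(m, n)) (e : 'I_n -> V) :
    'I_m -> V :=
  fun i => \sum_(j < n) A i j *: e j.

Section Action.
Variables (V W : lmodType R) (m n : nat).
Implicit Types (A : 'M[R]_(m, n)) (e : 'I_n -> V) (x : 'rV[R]_n).

Lemma dotP a x y e : dot (a *: x + y) e = a *: dot x e + dot y e.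
Proof.
rewrite /dot scaler_sumr -[RHS]big_split; apply: eq_bigr => j _ /=.
by rewrite !mxE scalerDl scalerA.
Qed.

Lemma dot0 e : dot 0 e = 0.
Proof. by rewrite /dot big1 // => j _; rewrite mxE scale0r. Qed.

Lemma dotZ a x e : dot (a *: x) e = a *: dot x e.
Proof. by rewrite -[a *: x]addr0 dotP dot0 addr0. Qed.

Lemma dotPr a x e e' : dot x (a *: e + e') = a *: dot x e + dot x e'.
Proof.
rewrite /dot scaler_sumr -[RHS]big_split; apply: eq_bigr => j _ /=.
by rewrite [(_ + _) j]/(a *: e j + e' j) scalerDr scalerCA.
Qed.

Lemma dot_mxact (x : 'rV_m) A e : dot x (mxact A e) = dot (x *m A) e.
Proof.
rewrite /dot /mxact; under eq_bigr do rewrite scaler_sumr.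
rewrite exchange_big; apply: eq_bigr => j _ /=.
by rewrite mxE scaler_suml; apply: eq_bigr => i _; rewrite scalerA.
Qed.

Lemma dot_delta j e : dot (delta_mx 0 j) e = e j.
Proof.
rewrite /dot (bigD1 j) //= big1 ?addr0 => [|i /negPf ij];
  rewrite !mxE eqxx ?eqxx ?scale1r //.
by rewrite ij scale0r.
Qed.

Lemma dot_comp (d : {linear V -> W}) x e : d (dot x e) = dot x (d \o e).
Proof. by rewrite linear_sum; apply: eq_bigr => j _; rewrite linearZ. Qed.

Lemma mxact_row A e i : mxact A e i = dot (row i A) e.
Proof. by apply: eq_bigr => j _; rewrite mxE. Qed.

Lemma mxactP A a e e' : mxact A (a *: e + e') = a *: mxact A e + mxact A e'.
Proof.
apply/funext => i; rewrite [RHS]/(a *: mxact A e i + mxact A e' i) /mxact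
  scaler_sumr.
rewrite -[RHS]big_split; apply: eq_bigr => j _.
by rewrite [(_ + _) j]/(a *: e j + e' j) scalerDr scalerCA.
Qed.

Lemma mxact0 A : mxact A (0 : 'I_n -> V) = 0.
Proof. by apply/funext => i; rewrite /mxact big1 // => j _;
  rewrite scaler0. Qed.

Lemma mxactB A e e' : mxact A (e - e') = mxact A e - mxact A e'.
Proof. by rewrite addrC -scaleN1r mxactP scaleN1r addrC. Qed.

Lemma mxact_comp (d : {linear V -> W}) A e : d \o mxact A e = mxact A (d \o e).
Proof.
by apply/funext => i /=; rewrite linear_sum; apply: eq_bigr => j _;
  rewrite linearZ.
Qed.

Lemma mxact_linear_subset A (X : set V) e :
  linear_subset X -> power_set X e -> power_set X (mxact A e).
Proof.
move=> XL Xe i; apply: linear_subset_sum => // j.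
by apply: linear_subsetZ.
Qed.

End Action.

Lemma comp_linearP (V W : lmodType R) (d : {linear V -> W}) n
    a (e e' : 'I_n -> V) :
  d \o (a *: e + e') = a *: (d \o e) + (d \o e').
Proof. by apply/funext => i; exact: linearP. Qed.

Lemma comp_linear0 (V W : lmodType R) (d : {linear V -> W}) n :
  d \o (0 : 'I_n -> V) = 0.
Proof. by apply/funext => i; exact: linear0. Qed.

Lemma comp_linearB (V W : lmodType R) (d : {linear V -> W}) n
    (e e' : 'I_n -> V) :
  d \o (e - e') = (d \o e) - (d \o e').
Proof. by apply/funext => i; exact: linearB. Qed.

(* Injectivity of [J] with respect to submodules of finite free modules. *)
Definition solvable_systems (J : lmodType R) : Prop :=
  forall m n (A : 'M[R]_(m, n)) (b : 'I_m -> J),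
    (forall x : 'rV_m, x *m A = 0 -> dot x b = 0) ->
    exists e : 'I_n -> J, b = mxact A e.

(* With [M = R^n / im A]: [syz_set A X] is [Hom(im A, X)], [img_set A X] is
   the image in it of [Hom(R^n, X)], and their quotient is [Ext^1(M, X)];
   [sol_set A X] is [Hom(M, X)].  Here [im A] is the row space of [A]. *)
Definition syz_set (V : lmodType R) m n (A : 'M[R]_(m, n)) (X : set V) :
    set ('I_m -> V) :=
  [set b | power_set X b /\ forall x : 'rV_m, x *m A = 0 -> dot x b = 0].

Definition img_set (V : lmodType R) m n (A : 'M[R]_(m, n)) (X : set V) :
    set ('I_m -> V) :=
  [set b | exists2 e, power_set X e & b = mxact A e].

Definition sol_set (V : lmodType R) m n (A : 'M[R]_(m, n)) (X : set V) :
    set ('I_n -> V) :=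
  [set e | power_set X e /\ mxact A e = 0].

Section Sets.
Variables (V : lmodType R) (m n : nat) (A : 'M[R]_(m, n)) (X : set V).
Hypothesis XL : linear_subset X.

Lemma img_set_linear : linear_subset (img_set A X).
Proof.
have XnL := power_set_linear n XL.
split; first by exists 0; [exact: XnL.1|rewrite mxact0].
move=> a _ _ [e Xe ->] [e' Xe' ->]; exists (a *: e + e'); first exact: XnL.2.
by rewrite mxactP.
Qed.

Lemma syz_set_linear : linear_subset (syz_set A X).
Proof.
have XmL := power_set_linear m XL.
split=> [|a b b' [Xb Ab] [Xb' Ab']]; split.
- exact: XmL.1.
- by move=> x _; rewrite /dot big1 // => j _; rewrite scaler0.
- exact: XmL.2.
- by move=> x xA; rewrite dotPr Ab // Ab' // scaler0 addr0.
Qed.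

Lemma sol_set_linear : linear_subset (sol_set A X).
Proof.
have XnL := power_set_linear n XL.
split=> [|a b b' [Xb Ab] [Xb' Ab']]; split.
- exact: XnL.1.
- exact: mxact0.
- exact: XnL.2.
- by rewrite mxactP Ab Ab' scaler0 addr0.
Qed.

Lemma img_set_syz : img_set A X `<=` syz_set A X.
Proof.
move=> _ [e Xe ->]; split; first exact: mxact_linear_subset.
by move=> x xA; rewrite dot_mxact xA dot0.
Qed.

End Sets.

End LinearSystems.

Section CocycleSets.
Variables (R : comNzRingType) (C : nat -> lmodType R).
Variable d : forall n, {linear C n -> C n.+1}.

Definition cocycle_set n : set (C n) := [set x | d n x = 0].

Definition boundary_set n : set (C n) := [set x | is_boundary d x].

End CocycleSets.

Arguments cocycle_set {R C} d n.
Arguments boundary_set {R C} d n.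

(** * Extension groups of cocycles, and associated primes of cohomology *)

Section Complexes.
Variable R : comNzRingType.
Hypothesis R_noetherian : noetherian_ring R.
Variables (J : nat -> lmodType R) (d : forall n, {linear J n -> J n.+1}).
Hypothesis dd : forall n x, d n.+1 (d n x) = 0.
Hypothesis J_solvable : forall n, solvable_systems (J n).

Notation Z := (cocycle_set d).
Notation B := (boundary_set d).

Lemma cocycle_set_linear n : linear_subset (Z n).
Proof.
split=> [|a x y zx zy]; rewrite /cocycle_set /=; first exact: linear0.
by rewrite linearP zx zy scaler0 addr0.
Qed.

Lemma boundary_set_linear n : linear_subset (B n).
Proof.
case: n => [|n]; rewrite /boundary_set; split=> /=.
- by [].
- by move=> a x y -> ->; rewrite scaler0 addr0.
- by exists 0; rewrite linear0.
- by move=> a _ _ [x ->] [y ->]; exists (a *: x + y); rewrite linearP.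
Qed.

Lemma boundary_cocycle n : B n `<=` Z n.
Proof.
case: n => [|n] x; rewrite /boundary_set /cocycle_set /=; first by move=> ->;
  exact: linear0.
by move=> [y ->]; exact: dd.
Qed.

Let ZL := cocycle_set_linear.
Let BL := boundary_set_linear.

(** [K] presents the row space of [A] as [R^m / im K], which allows dimension shifting from [A] to
    [K]. *)
Lemma left_kernel_rows m n (A : 'M[R]_(m, n)) :
  exists p (K : 'M[R]_(p, m)),
    K *m A = 0 /\ forall x : 'rV_m, x *m A = 0 -> exists c : 'rV_p, x = c *m K.
Proof.
pose S : set 'rV_m := [set x | x *m A = 0].
have SL : linear_subset S.
  split=> [|a x y xA yA]; rewrite /S /=; first exact: mul0mx.
  by rewrite mulmxDl -scalemxAl xA yA scaler0 addr0.
have [p [K KP]] := noetherian_rows R_noetherian SL.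
exists p, K; split=> [|x /KP //].
apply/row_matrixP => i; rewrite row_mul row0; apply/KP.
by exists (delta_mx 0 i); rewrite -rowE.
Qed.

Lemma choose_boundary n m (b : 'I_m -> J n.+1) :
  power_set (B n.+1) b -> exists c : 'I_m -> J n, b = d n \o c.
Proof.
move=> /choice[c cP]; exists c; apply/funext => i; exact: cP.
Qed.

Lemma power_cocycleP n m (e : 'I_m -> J n) : power_set (Z n) e <-> d n \o e = 0.
Proof.
split=> [Ze|e0 i]; first by apply/funext => i; exact: Ze.
exact: (congr1 (fun f => f i) e0).
Qed.

(** [mxact K c] represents the image of [d n \o c] under the connecting map from
    [Hom(R^p / im K, B n.+1)] to [Ext^1(R^p / im K, Z n)]. *)
Lemma mxact_lift_syz n p r (K : 'M[R]_(r, p)) (c : 'I_p -> J n) :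
  mxact K (d n \o c) = 0 -> syz_set K (Z n) (mxact K c).
Proof.
move=> Kc; split; first by apply/power_cocycleP; rewrite mxact_comp.
by move=> x xK; rewrite dot_mxact xK dot0.
Qed.

(** Exactness at the source of the connecting map: when the class vanishes, cocycles correct [c] to
    an element of [Hom(R^p / im K, J n)]. *)
Lemma img_set_lift n p r (K : 'M[R]_(r, p)) (c : 'I_p -> J n) :
  img_set K (Z n) (mxact K c) ->
  exists2 e, mxact K e = 0 & d n \o c = d n \o e.
Proof.
move=> [z /power_cocycleP dz Kc]; exists (c - z);
  first by rewrite mxactB Kc subrr.
by rewrite comp_linearB dz subr0.
Qed.

(** Every relation between the rows of [A] is a combination of rows of [K], so the corrected lift
    defines a map on the row space of [A], which [J_solvable] extends to [R^q]. *)
Lemma img_set_lift_solvable n p q r (A : 'M[R]_(p, q)) (K : 'M[R]_(r, p))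
    (c : 'I_p -> J n) :
  (forall x : 'rV_p, x *m A = 0 -> exists y : 'rV_r, x = y *m K) ->
  img_set K (Z n) (mxact K c) ->
  exists e, d n \o c = mxact A (d n \o e).
Proof.
move=> KP /img_set_lift[z Kz ->].
have [|e ->] := J_solvable (A := A) (b := z); last by exists e;
  rewrite mxact_comp.
by move=> x /KP[y ->]; rewrite -dot_mxact Kz /dot big1 // => j _;
  rewrite scaler0.
Qed.

Lemma mxact_syz p q r (V : lmodType R) (A : 'M[R]_(p, q)) (K : 'M[R]_(r, p))
    (X : set V) (b : 'I_p -> V) :
  K *m A = 0 -> syz_set A X b -> mxact K b = 0.
Proof.
move=> KA [_ Ab]; apply/funext => i.
by rewrite mxact_row; apply: Ab; rewrite -row_mul KA row0.
Qed.

(** The connecting map, kept as a relation because the lift [c] is not unique. *)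
Lemma lift_rel_linear n p r (K : 'M[R]_(r, p)) (P : set ('I_p -> J n)) :
  linear_subset P ->
  linear_rel (fun (b : 'I_p -> J n.+1) (u : 'I_r -> J n) =>
    exists c, [/\ P c, b = d n \o c & u = mxact K c]).
Proof.
move=> PL; split.
  by exists 0; split; [exact: PL.1|rewrite comp_linear0|rewrite mxact0].
move=> a _ _ _ _ [c [Pc -> ->]] [c' [Pc' -> ->]]; exists (a *: c + c').
by rewrite comp_linearP mxactP; split=> //; exact: PL.2.
Qed.

Variable t : nat.
Hypothesis H_wl : forall q, (q < t)%N -> rel_wl (Z q) (B q).

(** Let [M = R^q / im A]. [C] is the preimage of the image of [Ext^1(M, B i)] in [Ext^1(M, Z i)]:
    above it sits a subquotient of a power of [H^i], below it a quotient of [Ext^1(M, B i)]. *)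
Lemma ext1_cocycle_boundary i p q (A : 'M[R]_(p, q)) : (i < t)%N ->
  rel_wl (syz_set A (B i)) (img_set A (B i)) ->
  rel_wl (syz_set A (Z i)) (img_set A (Z i)).
Proof.
move=> it extB.
have iL := img_set_linear A (ZL i); have sL := syz_set_linear A (ZL i).
have pL := power_set_linear p (BL i).
have CL := linear_subset_add iL pL.
pose C : set ('I_p -> J i) := syz_set A (Z i) `&` sum_set (img_set A (Z i))
  (power_set (B i)).
have CL' : linear_subset C.
  split; first by split; [exact: sL.1|exact: CL.1].
  by move=> a x y [? ?] [? ?]; split; [exact: sL.2|exact: CL.2].
apply: (rel_wl_trans CL').
  apply: (rel_wlS sL pL _ _ (rel_wl_power (ZL i) (BL i) (H_wl it))) => //.
    by move=> b [].
  by move=> b [Ab Bb]; split=> //; exact: (sum_setr iL).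
apply: (rel_wl_linear_rel (rho := fun c b => img_set A (Z i) (c - b)))
  (img_set_linear A (BL i)) _ _ extB.
- split; first by rewrite subrr; exact: iL.1.
  move=> a x y x' y' xy xy'.
  by rewrite opprD addrACA -scalerBr; exact: iL.2.
- move=> c [[_ Ac] [s [b [[z Zz sz] Bb e]]]]; rewrite {s}sz in e; exists b;
  last first.
    by rewrite e addrK; exists z.
  split=> // x xA; have := Ac x xA; rewrite e.
  have -> : mxact A z + b = 1 *: mxact A z + b by rewrite scale1r.
  by rewrite dotPr dot_mxact xA dot0 scaler0 add0r.
move=> c b cb [e Be be]; rewrite -[c](subrK b); apply: linear_subsetD => //.
by exists e => // j; apply: boundary_cocycle.
Qed.

(* [Ext^1(M, Z i)] is weakly Laskerian: it is controlled by
   [Ext^1(M, H^i)] and [Ext^1(M, B i) = Ext^1(im A, Z (i - 1))]. *)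
Lemma ext1_cocycle_wl i p q (A : 'M[R]_(p, q)) : (i < t)%N ->
  rel_wl (syz_set A (Z i)) (img_set A (Z i)).
Proof.
(* The matrix is generalized since the induction step passes from [A] to the matrix [K] of its
   relations. *)
elim: i p q A => [|i IH] p q A it; apply: ext1_cocycle_boundary => //.
  have sL := syz_set_linear A (BL 0).
  apply: (rel_wlS sL sL _ _ (@rel_wl_refl _ _ _)) => //.
  move=> b [[Bb _] _]; exists 0; first exact: (power_set_linear q (BL 0)).1.
  by rewrite mxact0; apply/funext => j; exact: Bb.
have [r [K [KA KP]]] := left_kernel_rows A.
apply: (rel_wl_linear_rel (lift_rel_linear K (@linear_subsetT R _))
  (img_set_linear K (ZL i)) _ _ (IH _ _ K (ltnW it))).
  move=> b Ab; have [c bc] := choose_boundary Ab.1.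
  exists (mxact K c); last by exists c.
  by apply: mxact_lift_syz; rewrite -bc (mxact_syz KA Ab).
move=> b _ [c [_ -> ->]] /(img_set_lift_solvable KP)[e ->].
by exists (d i \o e) => // j; exists (e j).
Qed.

(* The coboundaries of [Hom(M, J)] for [M = R^q / im A]. *)
Definition sol_boundary p q (A : 'M[R]_(p, q)) n : set ('I_q -> J n) :=
  match n with
  | 0%N => [set 0]
  | n'.+1 => [set e | exists2 c, mxact A c = 0 & e = d n' \o c]
  end.

Arguments sol_boundary {p q} A n _.

Lemma sol_boundary_linear p q (A : 'M[R]_(p, q)) n :
  linear_subset (sol_boundary A n).
Proof.
case: n => [|n]; split=> /=.
- by [].
- by move=> a x y -> ->; rewrite scaler0 addr0.
- by exists 0; [exact: mxact0|rewrite comp_linear0].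
- move=> a _ _ [x Ax ->] [y Ay ->]; exists (a *: x + y);
  last by rewrite comp_linearP.
  by rewrite mxactP Ax Ay scaler0 addr0.
Qed.

(** For [M = R^q / im A], the connecting map embeds [Hom(M, B s.+1)] modulo the image of
    [Hom(M, J s)] in [Ext^1(M, Z s)]; in degree zero [B 0] is zero. *)
Lemma sol_boundary_wl p q (A : 'M[R]_(p, q)) n : (n <= t)%N ->
  rel_wl (sol_set A (B n)) (sol_boundary A n).
Proof.
have sL := sol_set_linear A (BL n).
case: n sL => [|s] sL st.
  apply: (rel_wlS sL sL _ _ (@rel_wl_refl _ _ _)) => // e [[Be _] _].
  by apply/funext => j; exact: Be.
apply: (rel_wl_linear_rel (lift_rel_linear A (@linear_subsetT R _))
  (img_set_linear A (ZL s)) _ _ (ext1_cocycle_wl (A := A) st)).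
  move=> e [Be Ae]; have [c ec] := choose_boundary Be.
  exists (mxact A c); last by exists c.
  by apply: mxact_lift_syz; rewrite -ec.
by move=> e _ [c [_ -> ->]] /img_set_lift[c' Ac' ->]; exists c'.
Qed.

(** Let [P] be the annihilator of [e]. If some [r] outside [P] brings all entries of [e] into [B t],
    then [P] comes from the kernel of the map to [Hom(M, H^t)]; otherwise some entry of [e] has
    annihilator [P] modulo [B t]. *)
Lemma finite_ass_sol p q (A : 'M[R]_(p, q)) :
  finite_set (rel_ass (Z t) (B t)) ->
  finite_set (rel_ass (sol_set A (Z t)) (sol_boundary A t)).
Proof.
move=> ZBfin; apply: (@sub_finite_set _ _
  (rel_ass (sol_set A (B t)) (sol_boundary A t) `|` rel_ass (Z t) (B t)));
    last first.
  rewrite finite_setU; split=> //.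
  exact: (sol_boundary_wl (A := A) (leqnn t) (sol_boundary_linear A t)).
move=> P [PP [e [Ze Ae] eP]].
have [[r rP Be]|nr] := pselect (exists2 r,
  r \notin submod_pred P & power_set (B t) (r *: e)).
  left; split=> //; exists (r *: e) => [|s]; first split=> //.
    by rewrite -[_ *: e]addr0 mxactP Ae mxact0 scaler0 addr0.
  rewrite scalerA; split=> [sP|/eP]; first by apply/eP; rewrite mulrC;
    exact: ideal_mulr.
  by move=> /PP.2/orP[//|rP']; rewrite rP' in rP.
right; split=> //.
have Pe r j : r \in submod_pred P -> B t (r *: e j).
  move=> /eP; have {}BP : sol_boundary A t `<=` power_set (B t).
    case: (t) => [|s] x /=; first by move=> ->.
    by move=> [c _ ->] j'; exists (c j').
  by move=> /BP; exact.
apply: contrapT => nj.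
(* If no entry worked, the product of the [r j] would be outside [P] and bring all of [e] into
   [B t]. *)
have /choice [r rP] : forall j, exists r,
  r \notin submod_pred P /\ B t (r *: e j).
  move=> j; apply: contrapT => nr'; apply: nj; exists (e j) => // r.
  split=> [|Br]; first exact: Pe.
  by apply/negPn/negP => rP; apply: nr'; exists r.
apply: nr; exists (\prod_j r j); first by apply: (prime_ideal_prod PP) => j;
  case: (rP j).
move=> j; have -> : (\prod_i r i *: e) j = \prod_(i | i != j) r i *: (r j *: e
  j).
  by rewrite [LHS]/(\prod_i r i *: e j) (bigD1 j) //= scalerA; congr (_ *: _);
    exact: mulrC.
by apply: (linear_subsetZ (BL t)); case: (rP j).
Qed.

Variable I : ideal R.
Hypothesis J_torsion_free : forall n (y : J n),
  (forall a, a \in submod_pred I -> a *: y = 0) -> y = 0.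

(* [Hom(R / I, H^t)] is weakly Laskerian because [Hom(R / I, J) = 0]. *)
Lemma torsion_cohomology_wl s : t = s.+1 ->
  rel_wl [set z | Z s.+1 z /\
            forall a, a \in submod_pred I -> B s.+1 (a *: z)] (B s.+1).
Proof.
move=> ts; have [l [g [gI gP]]] := ideal_gens R_noetherian I.
(* This column presents [R / I]. *)
pose A : 'M[R]_(l, 1) := \matrix_(i, j) g i.
have AE n (z : J n) i : mxact A (fun=> z) i = g i *: z.
  by rewrite /mxact big_ord1 mxE.
have [r [K [KA KP]]] := left_kernel_rows A.
(* Multiplication of [z] by scalars is a map from [I], presented by [K], to [B s.+1]; [rho] sends
   [z] to its connecting image in [Ext^1(I, Z s)]. *)
pose rho (z : J s.+1) (u : 'I_r -> J s) :=
  exists c, [/\ setT c, mxact A (fun=> z) = d s \o c & u = mxact K c].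
have rhoL : linear_rel rho.
  have [L0 LP] := lift_rel_linear K (@linear_subsetT R ('I_l -> J s)).
  split; first by rewrite /rho (_ : (fun=> 0) = 0 :> ('I_1 ->
    J s.+1)) // mxact0.
  move=> a x y x' y' xy xy'; rewrite /rho.
  rewrite (_ : (fun=> _) = a *: (fun=> x) + (fun=> x') :> ('I_1 ->
    J s.+1)) // mxactP.
  exact: LP.
apply: (rel_wl_linear_rel rhoL (img_set_linear K (ZL s)) _ _ (@ext1_cocycle_wl
  s _ _ K _)).
- move=> z [_ Iz].
  have [|c zc] := @choose_boundary s l (mxact A (fun=> z)).
    by move=> i; rewrite AE; apply: Iz.
  exists (mxact K c); last by exists c.
  apply: mxact_lift_syz; rewrite -zc.
  apply: (mxact_syz (X := setT) KA); apply: img_set_syz; first by [].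
  by exists (fun=> z).
- move=> z _ [c [_ zc ->]] /(img_set_lift_solvable KP)[e ce].
  (* [z - d s (e 0)] is killed by the generators of [I], hence is zero. *)
  exists (e 0); apply/eqP; rewrite -subr_eq0; apply/eqP.
  apply: J_torsion_free => a /gP[b ->].
  rewrite scaler_suml big1 // => i _; rewrite -scalerA scalerBr -AE zc ce.
  by rewrite /mxact big_ord1 mxE subrr scaler0.
by rewrite ts.
Qed.

(** Modulo boundaries, an element with annihilator [P] is killed by a power of [I], so the prime [P]
    contains [I] and the element is among those killed by [I]. *)
Lemma finite_ass_torsion_cohomology s : t = s.+1 ->
  (forall z, Z s.+1 z -> exists n, forall r, pow_ideal I n r ->
    B s.+1 (r *: z)) ->
  finite_set (rel_ass (Z s.+1) (B s.+1)).
Proof.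
move=> ts tors.
apply: sub_finite_set (torsion_cohomology_wl ts (BL s.+1) (@subset_refl _ _)).
move=> P [PP [z Zz zP]]; split=> //; exists z => //; split=> // a aI; apply/zP.
have [n nP] := tors z Zz.
apply/negPn/negP => /(prime_ideal_exp n PP)/negP; apply; apply/zP/nP.
exact: pow_ideal_exp.
Qed.

End Complexes.

Arguments sol_boundary {R J} d {p q} A n _.

(** * Comparison with generalized ideal transforms *)

Section Extension.
Variable R : comNzRingType.

(** Linearity reduces single-valuedness to the fibre over zero. The graph form suits partial maps
    whose domain is given as an image. *)
Lemma injective_graph_extension (E V : lmodType R) (G : V -> E -> Prop) :
  injective_module E -> linear_rel G -> (forall e, G 0 e -> e = 0) ->
  exists h : {linear V -> E}, forall x e, G x e -> h x = e.
Proof.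
move=> E_inj [G0 GP] Gfun.
have Guniq x e e' : G x e -> G x e' -> e = e'.
  move=> xe xe'; apply/eqP; rewrite -subr_eq0; apply/eqP; apply: Gfun.
  have := GP (-1) _ _ _ _ xe' xe.
  by rewrite !scaleN1r addNr [- e' + e]addrC.
have DL : linear_subset [set x | exists e, G x e].
  split; first by exists 0.
  by move=> a x y [e xe] [e' ye']; exists (a *: e + e'); exact: GP.
pose D := submodule_of DL.
have DP (x : submod_type D) : exists e, G (submod_val x) e.
  exact: (submodule_ofP DL _ (submod_valP x)).
pose g (x : submod_type D) : E := projT1 (cid (DP x)).
have gP x : G (submod_val x) (g x) by rewrite /g; case: cid.
have gL : linear g.
  by move=> a x y; apply: (Guniq _ _ _ (gP _)); apply: GP; exact: gP.
pose gl : {linear submod_type D -> E} := HB.pack g (GRing.isLinear.Build _ _ _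
  _ g gL).
have [h hP] := E_inj _ _ (val : {linear submod_type D -> V}) gl val_inj.
exists h => x e xe.
have xD : x \in submod_pred D by apply/submodule_ofP; exists e.
by have := hP (SubmodElt xD) => /= ->; apply: (Guniq _ _ _ (gP _)).
Qed.

Section Torsion.
Hypothesis R_noetherian : noetherian_ring R.
Variable I : ideal R.

Definition torsion_set (V : lmodType R) : set V :=
  [set y | exists n, forall r, pow_ideal I n r -> r *: y = 0].

Lemma torsion_set_linear (V : lmodType R) : linear_subset (@torsion_set V).
Proof.
split; first by exists 0%N => r _; rewrite scaler0.
move=> a x y [m xm] [n yn]; exists (maxn m n) => r rmn.
rewrite scalerDr scalerCA xm ?yn ?scaler0 ?addr0 //; apply: pow_ideal_mono rmn.
  exact: leq_maxr.
exact: leq_maxl.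
Qed.

(* Maps to [E / torsion] extend and lift to [E], for [E] injective: by
   Artin-Rees, [phi x |-> dot x b] is well defined on [phi (I ^ k R^m)] for
   large [k]. *)
Lemma torsion_extension (E X : lmodType R) m (phi : {linear 'rV[R]_m -> X})
    (b : 'I_m -> E) :
  injective_module E -> (forall x, phi x = 0 -> @torsion_set E (dot x b)) ->
  exists h : {linear X -> E},
    forall j, @torsion_set E (h (phi (delta_mx 0 j)) - b j).
Proof.
move=> E_inj tors.
pose S : set 'rV[R]_m := [set x | phi x = 0].
pose U : set 'rV[R]_m := [set x | dot x b = 0].
have SL : linear_subset S.
  split=> [|a x y Sx Sy]; rewrite /S /=; first exact: linear0.
  by rewrite linearP Sx Sy scaler0 addr0.
have UL : linear_subset U.
  split=> [|a x y Ux Uy]; rewrite /U /=; first exact: dot0.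
  by rewrite dotP Ux Uy scaler0 addr0.
have [p [A AP]] := noetherian_rows R_noetherian SL.
have /choice [K KP] : forall i, exists n, forall r, pow_ideal I n r ->
    r *: dot (row i A) b = 0.
  by move=> i; apply: tors; apply/AP; exists (delta_mx 0 i); rewrite -rowE.
(* Finitely many rows generate the kernel of [phi], so one power of [I] kills [dot x b] for all [x]
   in it, and Artin-Rees gives [k]. *)
have [k kP] : exists k, forall x : 'rV_m,
    (forall j, pow_ideal I k (x 0 j)) -> S x -> U x.
  apply: (artin_rees (N := \max_i K i) R_noetherian SL UL) => r x rN /AP[c ->].
  rewrite /U /= dotZ -dot_mxact /dot scaler_sumr big1 // => i _.
  rewrite scalerCA mxact_row KP ?scaler0 //.
  by apply: pow_ideal_mono rN; exact: leq_bigmax.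
pose G y e := exists x : 'rV_m, [/\ forall j, pow_ideal I k (x 0 j),
  y = phi x & e = dot x b].
have GL : linear_rel G.
  split; first by exists 0; split; [move=> j; rewrite mxE;
    exact: rpred0|rewrite linear0|rewrite dot0].
  move=> a _ _ _ _ [x [xk -> ->]] [y [yk -> ->]]; exists (a *: x + y).
  split; [move=> j; rewrite /pow_ideal /= !mxE|by rewrite linearP|by rewrite
    dotP].
  by apply: rpredD; [exact: ideal_mulr (xk j)|exact: yk].
have [|h hP] := injective_graph_extension E_inj GL.
  by move=> _ [x [xk /esym xS ->]]; apply: kP.
exists h => j; exists k => r rk.
have -> : h (phi (delta_mx 0 j)) - b j =
   h (phi (delta_mx 0 j)) - dot (delta_mx 0 j) b by rewrite dot_delta.
apply/eqP; rewrite scalerBr subr_eq0 -!linearZ /=; apply/eqP.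
apply: hP; exists (r *: delta_mx 0 j); split=> //.
  move=> i; rewrite !mxE eqxx /=; case: (i == j); rewrite ?mulr1 ?mulr0 //.
  exact: rpred0.
by rewrite dotZ.
Qed.

End Torsion.
End Extension.

(** * Ideal transforms of injective modules *)

Section Transform.
Variables (R : comNzRingType) (I : ideal R).
Hypothesis R_noetherian : noetherian_ring R.

Section Restriction.
Variables M E : lmodType R.

(** Stage zero consists of the maps on [I^0 M], a copy of [M], whence the composition with [val]. *)
Definition to_transform (h : Defs.Hom M E) : ideal_transform I M E :=
  dl_in (D := hom_pow_sys I M E) (n := 0)
    (hom_of (hom_fun h \o (val : {linear submod_type (ideal_pow_mod I M 0) ->
      M}))).

Lemma to_transform_linear : linear to_transform.
Proof.
move=> a f g; rewrite /to_transform -linearP; congr dl_in.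
by apply: hom_eqP.
Qed.

HB.instance Definition _ :=
  GRing.isLinear.Build R (Defs.Hom M E) (ideal_transform I M E) *:%R
    to_transform
    to_transform_linear.

Lemma to_transform_eq0 h : to_transform h = 0 <->
  exists k, forall x, x \in submod_pred (ideal_pow_mod I M k) ->
    hom_fun h x = 0.
Proof.
split=> [/dl_in_eqP[k [h0 [h0' e]]]|[k kP]].
  exists k => x xk; have := congr1 (fun f => hom_fun f (SubmodElt xk)) e.
  by [].
apply/dl_in_eqP; exists k, (leq0n k), (leq0n k); apply: hom_eqP => x.
exact: kP (submod_valP x).
Qed.

(** A map on [I^n M] extends to [M] because [E] is injective, and agrees with its extension at stage
    [n]. *)
Lemma to_transform_surj : injective_module E ->
  forall u, exists h, u = to_transform h.
Proof.
move=> E_inj u; have [n [f ->]] := dl_inP u.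
have [h hP] := E_inj _ _ (val : {linear submod_type (ideal_pow_mod I M n) -> M})
  (hom_fun f) val_inj.
exists (hom_of h); apply/dl_in_eqP; exists n, (leqnn n), (leq0n n).
by rewrite ds_map_id; apply: hom_eqP => x; rewrite -[RHS]/(h (val x)) hP.
Qed.

End Restriction.

Lemma to_transform_nat (M E E' : lmodType R) (d : {linear E -> E'})
    (h : Defs.Hom M E) :
  ideal_transform_map I M d (to_transform h) =
    to_transform (hom_of (d \o hom_fun h)).
Proof. by rewrite [LHS]dirlim_mapE; congr dl_in; apply: hom_eqP. Qed.

Lemma to_transform_eq0_gens (M E : lmodType R) m (g : 'I_m -> M)
    (h : Defs.Hom M E) :
  (forall x, exists c : 'I_m -> R, x = \sum_i c i *: g i) ->
  to_transform h = 0 <-> forall j, torsion_set I (hom_fun h (g j)).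
Proof.
move=> gP; rewrite to_transform_eq0; split=> [[k kP] j|].
  exists k => r rk; rewrite -linearZ; apply: kP.
  apply/asboolP; exists 1%N, (fun=> r), (fun=> g j).
  by split=> //; rewrite big_ord1.
move=> /choice[K KP]; exists (\max_i K i)%N => x /asboolP[n [a [y [aI _ ->]]]].
rewrite linear_sum big1 // => i _; have [c ->] := gP (y i).
rewrite linearZ /= linear_sum scaler_sumr big1 // => j _ /=.
rewrite linearZ /= scalerCA KP ?scaler0 //; apply: pow_ideal_mono (aI i).
exact: leq_bigmax.
Qed.

Section Unit.
Variable E : lmodType R.

Definition scale_hom (e : E) : R^o -> E := fun r => (r : R) *: e.

Lemma scale_hom_linear e : linear (scale_hom e).
Proof. by move=> a x y; rewrite /scale_hom scalerDl scalerA. Qed.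

HB.instance Definition _ e :=
  GRing.isLinear.Build R R^o E *:%R (scale_hom e) (scale_hom_linear e).

(** The canonical map from [E = Hom(R, E)] to [D_I(E)]. *)
Definition transform_unit (e : E) : ideal_transform I R^o E :=
  to_transform (hom_of (scale_hom e)).

Lemma transform_unit_linear : linear transform_unit.
Proof.
move=> a x y; rewrite /transform_unit -linearP; congr to_transform.
apply: hom_eqP => r; rewrite -[LHS]/(r *: (a *: x + y)).
by rewrite -[RHS]/(a *: (r *: x) + r *: y) scalerDr scalerCA.
Qed.

HB.instance Definition _ :=
  GRing.isLinear.Build R E (ideal_transform I R^o E) *:%R transform_unit
    transform_unit_linear.

Lemma transform_unit_eq0 e : transform_unit e = 0 <-> torsion_set I e.
Proof.
rewrite (to_transform_eq0_gens (g := fun _ : 'I_1 => 1 : R^o)) => [|x];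
  last first.
  by exists (fun=> x); rewrite big_ord1 [RHS]mulr1.
split=> [/(_ 0)|te j]; rewrite -[hom_fun _ _]/(1 *: e) scale1r //.
Qed.

Lemma transform_unit_surj : injective_module E ->
  forall u, exists e, u = transform_unit e.
Proof.
move=> E_inj u; have [h ->] := to_transform_surj E_inj u.
exists (hom_fun h (1 : R^o)); congr to_transform; apply: hom_eqP => r.
by rewrite -[RHS]/((r : R) *: hom_fun h 1) -linearZ /= [r *: _]mulr1.
Qed.

End Unit.

Lemma transform_unit_nat (E E' : lmodType R) (d : {linear E -> E'}) e :
  ideal_transform_map I R^o d (transform_unit e) = transform_unit (d e).
Proof.
rewrite to_transform_nat; congr to_transform; apply: hom_eqP => r.
exact: linearZ.
Qed.

(** If [I] kills the class of [e], each [a *: e] with [a] in [I] is torsion, and then so is [e] by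
    [pow_ideal_colon]. *)
Lemma transform_torsion_free (E : lmodType R) : injective_module E ->
  forall y : ideal_transform I R^o E,
  (forall a, a \in submod_pred I -> a *: y = 0) -> y = 0.
Proof.
move=> E_inj y; have [e ->] := transform_unit_surj E_inj y => Iy.
apply/transform_unit_eq0; apply: (pow_ideal_colon R_noetherian (S := [set 0])).
  by split=> // a x x' -> ->; rewrite scaler0 addr0.
by move=> a /Iy; rewrite -linearZ => /transform_unit_eq0.
Qed.

(** Lifted to [E], the compatibility condition says that relations take torsion values, so
    [torsion_extension], applied to multiplication by [A], solves the lifted system up to
    torsion. *)
Lemma transform_solvable (E : lmodType R) : injective_module E ->
  solvable_systems (ideal_transform I R^o E).
Proof.
move=> E_inj m n A b xb.
have /choice [b' bb'] := fun i => transform_unit_surj E_inj (b i).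
have eb : b = @transform_unit E \o b' by apply/funext.
rewrite eb {b bb' eb} in xb *.
have [|h hP] := torsion_extension R_noetherian (I := I) (phi := mulmxr A) (b :=
  b') E_inj.
  by move=> x xA; apply/transform_unit_eq0; rewrite dot_comp; apply: xb.
exists (@transform_unit E \o (fun j => h (delta_mx 0 j))).
rewrite -mxact_comp; apply/funext => i /=; apply/esym/eqP.
rewrite -subr_eq0 -linearB; apply/eqP/transform_unit_eq0.
rewrite mxact_row -dot_comp; suff <- : (delta_mx 0 i :
  'rV_m) *m A = dot (row i A) (fun j => delta_mx 0 j : 'rV_n).
  exact: hP.
by rewrite -rowE {1}[row i A]row_sum_delta.
Qed.

Section Comparison.
Variables (M E : lmodType R) (m : nat) (g : 'I_m -> M).
Hypothesis gP : forall x, exists c : 'I_m -> R, x = \sum_i c i *: g i.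
Variables (p : nat) (A : 'M[R]_(p, m)).
Hypothesis AP : forall x : 'rV_m, dot x g = 0 <-> exists c : 'rV_p, x = c *m A.

(* The isomorphism [D_I(M, E) = Hom(M, D_I(E))], seen as a correspondence
   between lifts of both sides to [Hom(M, E)]. *)
Definition gen_values (h : Defs.Hom M E) : 'I_m -> ideal_transform I R^o E :=
  @transform_unit E \o hom_fun h \o g.

Lemma gen_values_linear : linear gen_values.
Proof.
move=> a f h; apply/funext => j; rewrite -[RHS]/(a *: transform_unit (hom_fun f
  (g j))
  + transform_unit (hom_fun h (g j))).
by rewrite -linearP.
Qed.

HB.instance Definition _ :=
  GRing.isLinear.Build R (Defs.Hom M E) ('I_m -> ideal_transform I R^o E) *:%R
    gen_values gen_values_linear.

Lemma gen_values_eq0 h : gen_values h = 0 <-> to_transform h = 0.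
Proof.
rewrite (to_transform_eq0_gens _ gP); split=> [e0 j|hg].
  by apply/transform_unit_eq0; exact: (congr1 (fun f => f j) e0).
by apply/funext => j; apply/transform_unit_eq0.
Qed.

Lemma gen_values_sol h : mxact A (gen_values h) = 0.
Proof.
rewrite /gen_values -!mxact_comp; apply/funext => i /=.
rewrite mxact_row (_ : dot _ g = 0) ?linear0 //.
by apply/AP; exists (delta_mx 0 i); rewrite -rowE.
Qed.

(** By [torsion_extension] along the presentation of [M], some map on [M] has values on the
    generators that differ from a lift of [e] by torsion. *)
Lemma gen_values_surj e : injective_module E ->
  mxact A e = 0 -> exists h, e = gen_values h.
Proof.
move=> E_inj Ae.
have /choice [b eb] := fun i => transform_unit_surj E_inj (e i).
have {eb} eb : e = @transform_unit E \o b by apply/funext.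
have phiL : linear (fun x : 'rV[R]_m => dot x g) by move=> a x y; exact: dotP.
pose phi : {linear 'rV[R]_m -> M} := HB.pack (fun x : 'rV[R]_m => dot x g)
  (GRing.isLinear.Build _ _ _ _ _ phiL).
have [|h hP] := torsion_extension R_noetherian (I := I) (phi := phi) (b := b)
  E_inj.
  move=> x /AP[c ->]; apply/transform_unit_eq0.
  by rewrite dot_comp -eb -dot_mxact Ae /dot big1 // => j _; rewrite scaler0.
exists (hom_of h); rewrite eb; apply/funext => j; apply/esym/eqP => /=.
rewrite -[X in X == _]/(transform_unit (h (g j))) -subr_eq0 -linearB.
apply/eqP/transform_unit_eq0.
by move: (hP j); rewrite /= dot_delta.
Qed.

End Comparison.

Lemma gen_values_nat (M E E' : lmodType R) m (g : 'I_m -> M)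
    (d : {linear E -> E'}) (h : Defs.Hom M E) :
  gen_values g (hom_of (d \o hom_fun h)) =
    ideal_transform_map I R^o d \o gen_values g h.
Proof. by apply/funext => j; rewrite /gen_values /= transform_unit_nat. Qed.

(** * Ideal transforms of an injective resolution *)

Section Resolution.
Variables (N : lmodType R) (E : injective_resolution N).
Let d M n := ideal_transform_map I M (ir_diff E n).

Let E_inj n : injective_module (E n) := @ir_injective _ _ E n.

Lemma transform_complex n x : d R^o n.+1 (d R^o n x) = 0.
Proof.
have [e ->] := transform_unit_surj (@E_inj n) x.
rewrite /d !transform_unit_nat; suff -> : ir_diff E n.+1 (ir_diff E n e) = 0.
  exact: linear0.
by apply/ir_exact; exists e.
Qed.

(** On [Hom(M, E n)], [to_transform] and [gen_values] have the same kernel; the first is onto, the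
    second reaches all solutions. So cocycles and boundaries are compared on common lifts [h]. *)
Lemma transform_ass_sub (M : lmodType R) m (g : 'I_m -> M)
    p (A : 'M[R]_(p, m)) n :
  (forall x, exists c : 'I_m -> R, x = \sum_i c i *: g i) ->
  (forall x : 'rV_m, dot x g = 0 <-> exists c : 'rV_p, x = c *m A) ->
  rel_ass (cocycle_set (d M) n) (boundary_set (d M) n) `<=`
  rel_ass (sol_set A (cocycle_set (d R^o) n)) (sol_boundary (d R^o) A n).
Proof.
move=> gP AP P [PP [u du uP]]; split=> //.
have [h uh] := to_transform_surj (@E_inj n) u; rewrite {u}uh in du uP.
exists (gen_values g h) => [|r].
  split; last exact: gen_values_sol.
  move: du; rewrite /cocycle_set /= [d M n _]to_transform_nat =>
    /(gen_values_eq0 gP).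
  by rewrite gen_values_nat => dh j; exact: (congr1 (fun f => f j) dh).
rewrite uP -!linearZ /=; move: ((r : R) *: h : Defs.Hom M (E n)) => {uP du} {}h.
case: n h => [|n] h; rewrite /boundary_set /=;
  first by rewrite (gen_values_eq0 gP).
split=> [[v]|[c Ac hc]].
  have [h' ->] := to_transform_surj (@E_inj n) v => e.
  exists (gen_values g h'); first exact: gen_values_sol.
  rewrite -gen_values_nat; apply/eqP; rewrite -subr_eq0 -linearB; apply/eqP.
  apply/(gen_values_eq0 gP); rewrite linearB /= e.
  by rewrite [d M n _]to_transform_nat subrr.
have [h' ch'] := gen_values_surj AP (@E_inj n) Ac.
exists (to_transform h'); rewrite [RHS]to_transform_nat.
apply/eqP; rewrite -subr_eq0 -linearB; apply/eqP/(gen_values_eq0 gP).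
by rewrite linearB /= gen_values_nat hc ch' subrr.
Qed.

(** If [I ^ k] kills the differential of a lift [e], then [r *: e], for [r] in [I ^ k], is a cocycle
    of [E], hence a boundary by exactness. *)
Lemma transform_cohomology_torsion n z :
  cocycle_set (d R^o) n.+1 z -> exists k, forall r, pow_ideal I k r ->
  boundary_set (d R^o) n.+1 (r *: z).
Proof.
have [e ->] := transform_unit_surj (@E_inj n.+1) z.
rewrite /cocycle_set /= /d transform_unit_nat => /transform_unit_eq0[k kP].
exists k => r rk; have /ir_exact[y ry] : ir_diff E n.+1 (r *: e) = 0.
  by rewrite linearZ; exact: kP.
exists (transform_unit y); rewrite /d transform_unit_nat -ry.
by rewrite [RHS]linearZ.
Qed.

(** Multiplying by a power of some [a] in [I] outside [P] keeps the annihilator of [y] and moves its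
    lift into [N]. *)
Lemma transform_finite_ass0 : weakly_laskerian N ->
  finite_set (rel_ass (cocycle_set (d R^o) 0) (boundary_set (d R^o) 0)).
Proof.
move=> /weakly_laskerian_rel Nwl.
have TL := @torsion_set_linear R I N.
apply: sub_finite_set (Nwl _ TL _); last by move=> _ ->; exact: TL.1.
move=> P [PP [y dy yP]]; split=> //.
(* Otherwise [I] would kill [y], which would then vanish. *)
have [a aI aP] : exists2 a, a \in submod_pred I & a \notin submod_pred P.
  apply: contrapT => IP; have/negP := PP.1; apply; apply/yP.
  rewrite scale1r; apply: (transform_torsion_free (@E_inj 0)) => a aI.
  by apply/yP/negPn/negP => aP; apply: IP; exists a.
have [e ye] := transform_unit_surj (@E_inj 0) y; rewrite {y}ye in dy yP.
move: dy; rewrite /cocycle_set /= /d transform_unit_nat =>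
  /transform_unit_eq0[k kP].
have [v ev] : exists v, a ^+ k *: e = ir_aug E v.
  by apply/ir_exact0; rewrite linearZ; apply: kP; exact: pow_ideal_exp.
have akP := prime_ideal_exp k PP aP.
exists v => // r; transitivity (r * a ^+ k \in submod_pred P).
  split=> [rP|/PP.2/orP[//|]]; first by rewrite mulrC; exact: ideal_mulr.
  by rewrite (negPf akP).
rewrite yP /boundary_set /= -linearZ transform_unit_eq0 -scalerA ev.
split=> -[l lP]; exists l => s /lP sv.
  by apply: (@ir_aug_inj _ _ E); rewrite linear0 !linearZ.
by have := congr1 (ir_aug E) sv; rewrite linear0 !linearZ /= scalerCA.
Qed.

End Resolution.
End Transform.

(** * Cohomology as cocycles modulo boundaries, and the conclusion *)

Lemma cohomology_rel_wl (R : comNzRingType) (C : nat -> lmodType R)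
    (d : forall n, {linear C n -> C n.+1}) n :
  weakly_laskerian (cohomology d n) ->
  rel_wl (cocycle_set d n) (boundary_set d n).
Proof.
move=> /weakly_laskerian_rel.
pose rho (z : C n) (u : cohomology d n) := exists z' :
  submod_type (cocycles d n),
  z = submod_val z' /\ u = (\pi_(quotmod (coboundaries d n)) z')%qT.
apply: (rel_wl_linear_rel (rho := rho)).
- split; first by exists 0; split=> //; apply/esym/quotmod_pi_eq0;
  exact: rpred0.
  move=> a _ _ _ _ [z [-> ->]] [z' [-> ->]]; exists (a *: z + z'); split=> //.
  by rewrite quotmod_piD; congr (_ + _); exact/esym/quotmod_pi_scale.
- by split=> // a x y -> ->; rewrite scaler0 addr0.
- move=> z dz; have zZ : z \in submod_pred (cocycles d n) by apply/eqP.
  by exists (\pi_(quotmod (coboundaries d n)) (SubmodElt zZ))%qT => //;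
    exists (SubmodElt zZ).
by move=> _ _ [z [-> ->]] /quotmod_pi_eq0/asboolP.
Qed.

Lemma cohomology_ass_sub (R : comNzRingType) (C : nat -> lmodType R)
    (d : forall n, {linear C n -> C n.+1}) n :
  associated_primes (cohomology d n) `<=` rel_ass (cocycle_set d n)
    (boundary_set d n).
Proof.
move=> P [PP [x xP]]; split=> //; have [z xz] := quotmodP x.
exists (submod_val z); first by have /eqP := submod_valP z.
move=> r; rewrite xP xz -[_ *: _]quotmod_pi_scale.
by split=> [/eqP/quotmod_pi_eq0/asboolP|B];
  last by apply/eqP/quotmod_pi_eq0/asboolP.
Qed.

Theorem corollary3p6 (R : comNzRingType) (I : ideal R) (M N : lmodType R)
    (E : injective_resolution N) (t : nat)
    (R_noetherian : noetherian_ring R)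
    (M_fg : finitely_generated M)
    (N_wl : weakly_laskerian N)
    (RiDN_wl : forall i, (i < t)%N ->
       weakly_laskerian (derived_ideal_transform I R^o E i)) :
  finite_set (associated_primes (derived_ideal_transform I M E t)).
Proof.
have E_inj n : injective_module (E n) := @ir_injective _ _ E n.
have [m [g gP]] := M_fg.
have kerL : linear_subset [set x : 'rV[R]_m | dot x g = 0].
  split=> [|a x y gx gy] /=; first exact: dot0.
  by rewrite dotP gx gy scaler0 addr0.
(* The rows of [A] generate the relations between the generators [g], so [A] presents [M]. *)
have [p [A AP]] := noetherian_rows R_noetherian kerL.
apply: (sub_finite_set (subset_trans (@cohomology_ass_sub _ _ _ _)
  (transform_ass_sub R_noetherian (n := t) gP AP))).
have J_solv n := transform_solvable (I := I) R_noetherian (E_inj n).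
have dd := @transform_complex R I N E.
have H_wl q (qt : (q < t)%N) := cohomology_rel_wl (RiDN_wl q qt).
(* This reduces the claim to the associated primes of [H^t] for the ordinary transform. *)
apply: (finite_ass_sol R_noetherian dd J_solv H_wl).
case: t H_wl {RiDN_wl} => [|t] H_wl.
  exact: transform_finite_ass0.
apply: (finite_ass_torsion_cohomology R_noetherian dd J_solv H_wl _ (erefl _)).
  by move=> n; apply: transform_torsion_free.
exact: transform_cohomology_torsion.
Qed.
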